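(* Assume that $t\leq n$ and let $\mathcal{K}\subset L^2(\mathrm{Hom}(X\to U))$ be an $\mathrm{Sp}(V)$-subrepresentation of $\mu_{U\otimes V}$ of rank $r$. Then $t-r$ is even and $\mathcal{K}$ is contained in the span of all tensor power CSS codes $C_N$, where $N$ ranges over the isotropic subspaces of $U$ with $\dim N=(t-r)/2$.
   Context: Notation. $q$ is a power of an odd prime $p$. For $\lambda\in\mathbb{F}_q^\times$, $\ell_\lambda=+1$ if $\lambda$ is a square and $-1$ otherwise. $\omega(\lambda)=\exp\big(\tfrac{2\pi i}{p}\mathrm{Tr}(\lambda)\big)$ with $\mathrm{Tr}:\mathbb{F}_q\to\mathbb{F}_p$ the field trace. For a finite set $S$, $L^2(S)$ is the Hilbert space of complex functions on $S$, and $\delta_s$ is the indicator function of $s\in S$. The transpose of a linear map $A$ is $A^t$. A map $A:Y^*\to Y$ is symmetric if $A=A^t$; one writes $A(y,y')=y'(Ay)$. Oscillator representation. For a finite-dimensional $\mathbb{F}_q$-space $Y$, $Y\oplus Y^*$ carries the symplectic form $[x\oplus y,x'\oplus y']=y'(x)-y(x')$. The oscillator representation $\mu_{Y\oplus Y^*}$ of $\mathrm{Sp}(Y\oplus Y^* )$ on $L^2(Y^* )$ is the representation determined on generators by $\mu(N_A)\delta_y=\omega(2^{-1}A(y,y))\,\delta_y$, $\ \mu(D_C)\delta_y=\ell_{\det C}\,\delta_{C^{-t}y}$, $\ \mu(J_B)\delta_y=\gamma(B)^{-1}\sum_{y'\in Y^*}\omega(B(y,y'))\,\delta_{y'}$,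 where $N_A=\begin{pmatrix}1&A\\0&1\end{pmatrix}$ ($A:Y^*\to Y$ symmetric), $D_C=\begin{pmatrix}C&0\\0&C^{-t}\end{pmatrix}$ ($C\in GL(Y)$), $J_B=\begin{pmatrix}0&B\\-B^{-1}&0\end{pmatrix}$ ($B:Y^*\to Y$ symmetric invertible), and $\gamma(B)=\sum_{y\in Y^*}\omega(-2^{-1}B(y,y))$. Setting. $X$ is an $n$-dimensional $\mathbb{F}_q$-space and $V=X\oplus X^*$. $U$ is a $t$-dimensional $\mathbb{F}_q$-space with a non-degenerate symmetric bilinear form $\beta$. Then $U\otimes V=(U\otimes X)\oplus(U\otimes X^* )$ is symplectic, the two summands being dual via $\langle u\otimes x,v\otimes y\rangle=\beta(u,v)y(x)$; identifying $U\otimes X^*=\mathrm{Hom}(X\to U)$, the oscillator representation $\mu_{U\otimes V}$ acts on $L^2(\mathrm{Hom}(X\to U))$. It is regarded as a representation of $\mathrm{Sp}(V)$ via $S\mapsto \mathrm{Id}_U\otimes S\in\mathrm{Sp}(U\otimes V)$. Rank. For a (nonzero) representation $\pi$ of $\mathrm{Sp}(V)$, its restriction to the abelian group $\{N_A\mid A:X^*\to X\text{ symmetric}\}$ decomposes into characters $N_A\mapsto\omega(\mathrm{tr}\,AB)$ with $B:X\to X^*$ symmetric, called $\mathcal{N}$-weights. The rank of $\pi$ is the maximal rank of the $\mathcal{N}$-weights $B$ that occur. On $\delta_F$, $F\in\mathrm{Hom}(X\to U)$, the $\mathcal N$-weight in $\mu_{U\otimes V}$ is $2^{-1}F^TF$,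 where $F^TF$ is the form $(F^TF)(x,y)=\beta(Fx,Fy)$ on $X$. Hence the rank of $\mathcal{K}$ is $\max\{\mathrm{rank}\,F^TF\mid F\in\mathrm{supp}\,\Phi,\ \Phi\in\mathcal{K}\}$. CSS codes. A subspace $N\subset U$ is isotropic if $N\subset N^\perp$ (orthogonal complement with respect to $\beta$). The tensor power CSS code $C_N\subset L^2(\mathrm{Hom}(X\to U))$ is the space of all functions $\Phi$ with $\mathrm{supp}\,\Phi\subset\mathrm{Hom}(X\to N^\perp)$ and $\Phi(F)=\Phi(F')$ whenever $F-F'\in\mathrm{Hom}(X\to N)$. *)

(* Defs.v *)
From HB Require Import structures.
From mathcomp Require Import all_boot all_order all_algebra all_fingroup all_field.
From mathcomp Require Import sesquilinear complex.
From mathcomp Require Import reals trigo.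
From mathcomp Require Import ring.

Set Implicit Arguments.
Unset Strict Implicit.
Unset Printing Implicit Defensive.

Import Order.TTheory GRing.Theory Num.Theory passmx.
Local Open Scope ring_scope.

Section Characters.
Variables (p : nat) (F : finFieldType) (pcharFp : p \in [pchar F]).

(* The trace of F over its prime field.  The library's galTrace takes values in
   the large field; Tr a is the unique c in F_p whose image there is
   galTrace a (lemma TrE). *)
Definition Tr (a : F) : 'F_p :=
  odflt 0 [pick c : 'F_p |
    c%:A == galTrace 1%AS {:pPrimeCharType pcharFp} (a : pPrimeCharType pcharFp)].

Lemma TrE (a : F) :
  (Tr a)%:A = galTrace 1%AS {:pPrimeCharType pcharFp} (a : pPrimeCharType pcharFp).
Proof.
rewrite /Tr; case: pickP => [c /eqP //|no_c].
have gal1 : galois 1%AS {:pPrimeCharType pcharFp} by apply: finField_galois; rewrite sub1v.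
have /vlineP[c cE] := mem_galTrace gal1 (memvf (a : pPrimeCharType pcharFp)).
by have := no_c c; rewrite cE eqxx.
Qed.

Definition legendre (C : pzRingType) (a : F) : C :=
  if [exists b : F, b ^+ 2 == a] then 1 else -1.

Definition omega (R : realType) (a : F) : R[i] :=
  let x : R := 2 * pi / p%:R * (Tr a)%:R in (cos x +i* sin x)%C.

End Characters.

Arguments legendre {F} C a.

Definition lfun_det (F : fieldType) (Y : vectType F) (C : 'End(Y)) : F :=
  \det (mxof (vbasis {:Y}) (vbasis {:Y}) C).

Definition lfun_tr (F : fieldType) (Y : vectType F) (C : 'End(Y)) : F :=
  \tr (mxof (vbasis {:Y}) (vbasis {:Y}) C).

(* Complex functions on a vector space Y over a finite field.  The alias
   finvect_type is Y itself, seen as a finType. *)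
Definition L2 (R : realType) (F : finFieldType) (Y : vectType F) :
    vectType R[i] :=
  {ffun finvect_type Y -> R[i]^o}.

Definition delta (R : realType) (F : finFieldType) (Y : vectType F) (y : Y) :
    L2 R Y :=
  [ffun z : finvect_type Y => (z == y :> Y)%:R].

(* Y' plays the role of the dual of Y through a perfect pairing
   pair x y = y(x). *)
Section Symplectic.
Variables (F : fieldType) (Y Y' : vectType F) (pair : Y -> Y' -> F).

Definition sympl_form (v w : Y * Y') : F := pair v.1 w.2 - pair w.1 v.2.

Definition symplectic (S : 'End((Y * Y')%type)) : Prop :=
  forall v w, sympl_form (S v) (S w) = sympl_form v w.

Definition qform (A : 'Hom(Y', Y)) (y y' : Y') : F := pair (A y) y'.

Definition symmetric_map (A : 'Hom(Y', Y)) : Prop :=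
  forall y y', qform A y y' = qform A y' y.

(* D = C^{-t} *)
Definition contragredient (C : 'End(Y)) (D : 'End(Y')) : Prop :=
  forall x y, pair (C x) (D y) = pair x y.

Definition N_map (A : 'Hom(Y', Y)) : 'End((Y * Y')%type) :=
  linfun (fun v : Y * Y' => (v.1 + A v.2, v.2)).

Definition D_map (C : 'End(Y)) (D : 'End(Y')) : 'End((Y * Y')%type) :=
  linfun (fun v : Y * Y' => (C v.1, D v.2)).

Definition J_map (B : 'Hom(Y', Y)) : 'End((Y * Y')%type) :=
  linfun (fun v : Y * Y' => (B v.2, - (B^-1)%VF v.1)).

Lemma N_mapE A v : N_map A v = (v.1 + A v.2, v.2).
Proof.
pose f (v : Y * Y') := (v.1 + A v.2, v.2).
have f_lin : linear f.
  by move=> a u w; congr (_, _); rewrite /= linearP scalerDr addrACA.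
pose fL : {linear _ -> _} := HB.pack f (GRing.isLinear.Build _ _ _ _ f f_lin).
exact: (lfunE fL).
Qed.

Lemma D_mapE C D v : D_map C D v = (C v.1, D v.2).
Proof.
pose f (v : Y * Y') := (C v.1, D v.2).
have f_lin : linear f by move=> a u w; congr (_, _); rewrite /= linearP.
pose fL : {linear _ -> _} := HB.pack f (GRing.isLinear.Build _ _ _ _ f f_lin).
exact: (lfunE fL).
Qed.

Lemma J_mapE B v : J_map B v = (B v.2, - (B^-1)%VF v.1).
Proof.
pose f (v : Y * Y') := (B v.2, - (B^-1)%VF v.1).
have f_lin : linear f.
  by move=> a u w; congr (_, _); rewrite /= linearP // opprD scalerN.
pose fL : {linear _ -> _} := HB.pack f (GRing.isLinear.Build _ _ _ _ f f_lin).
exact: (lfunE fL).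
Qed.

End Symplectic.

Section Oscillator.
Variables (p : nat) (F : finFieldType) (pcharFp : p \in [pchar F]).
Variables (R : realType) (Y Y' : vectType F) (pair : Y -> Y' -> F).

Local Notation om := (omega pcharFp R).

Definition gauss_sum (B : 'Hom(Y', Y)) : R[i] :=
  \sum_(y : finvect_type Y') om (- (2%:R^-1 * qform pair B y y)).

(* The values of mu outside Sp(Y + Y') are irrelevant. *)
Record oscillator (mu : 'End((Y * Y')%type) -> 'End(L2 R Y')) : Prop :=
  Oscillator {
    osc_1 : mu \1%VF = \1%VF;
    osc_M : forall S T, symplectic pair S -> symplectic pair T ->
      mu (S \o T)%VF = (mu S \o mu T)%VF;
    osc_N : forall A, symmetric_map pair A -> forall y,
      mu (N_map A) (delta R y) = om (2%:R^-1 * qform pair A y y) *: delta R y;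
    osc_D : forall (C : 'End(Y)) (D : 'End(Y')), bijective C -> contragredient pair C D ->
      forall y, mu (D_map C D) (delta R y) = legendre R[i] (lfun_det C) *: delta R (D y);
    osc_J : forall B : 'Hom(Y', Y), symmetric_map pair B -> bijective B -> forall y,
      mu (J_map B) (delta R y) =
        (gauss_sum B)^-1 *:
          \sum_(y' : finvect_type Y') om (qform pair B y y') *: delta R (y' : Y')
  }.

End Oscillator.

Definition dual (F : fieldType) (X : vectType F) : vectType F := 'Hom(X, F^o).

Definition eval (F : fieldType) (X : vectType F) (x : X) (y : dual X) : F := y x.

(* U (x) X* is Hom(X, U) via  u (x) y = (x |-> y(x) u), and likewise U (x) X is
   Hom(X*, U) via  u (x) x = (y |-> y(x) u). *)
Section Tensor.
Variables (F : fieldType) (X U : vectType F).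

Definition tensX (u : U) (x : X) : 'Hom(dual X, U) :=
  linfun (fun y : dual X => (y x : F) *: u).

Definition tensX' (u : U) (y : dual X) : 'Hom(X, U) :=
  linfun (fun x : X => (y x : F) *: u).

Definition UV : vectType F := ('Hom(dual X, U) * 'Hom(X, U))%type.

Definition tens (u : U) (v : X * dual X) : UV := (tensX u v.1, tensX' u v.2).

Definition bas (i : 'I_(\dim {:X})) : X := (vbasis {:X})`_i.

Definition dbas (i : 'I_(\dim {:X})) : dual X :=
  linfun (fun x : X => coord (vbasis {:X}) i x : F^o).

(* The bilinear pairing with <u (x) x, v (x) y> = beta(u, v) y(x)
   (lemma tens_pairE). *)
Definition tens_pair (beta : U -> U -> F)
    (G : 'Hom(dual X, U)) (H : 'Hom(X, U)) : F :=
  \sum_i beta (G (dbas i)) (H (bas i)).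

(* Id_U (x) S: the linear map with u (x) v |-> u (x) S v (lemma id_tensE), using
   (G, H) = \sum_i G(e_i^* ) (x) e_i + H(e_i) (x) e_i^*. *)
Definition id_tens (S : 'End((X * dual X)%type)) : 'End(UV) :=
  linfun (fun Z : UV => \sum_i (tens (Z.1 (dbas i)) (S (bas i, 0))
                              + tens (Z.2 (bas i)) (S (0, dbas i))) : UV).

Lemma tensXE u x y : tensX u x y = (y x : F) *: u.
Proof.
pose f (y : dual X) : U := (y x : F) *: u.
have f_lin : linear f.
  by move=> a v w; rewrite /f add_lfunE scale_lfunE scalerDl scalerA.
pose fL : {linear _ -> _} := HB.pack f (GRing.isLinear.Build _ _ _ _ f f_lin).
exact: (lfunE fL).
Qed.

Lemma tensX'E u y x : tensX' u y x = (y x : F) *: u.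
Proof.
pose f (x : X) : U := (y x : F) *: u.
have f_lin : linear f by move=> a v w; rewrite /f linearP scalerDl scalerA.
pose fL : {linear _ -> _} := HB.pack f (GRing.isLinear.Build _ _ _ _ f f_lin).
exact: (lfunE fL).
Qed.

Lemma tens_linearr u : linear (tens u).
Proof.
move=> a v w; congr (_, _); apply/lfunP => z;
  rewrite add_lfunE scale_lfunE ?tensXE ?tensX'E /=.
  by rewrite linearP scalerDl scalerA.
by rewrite add_lfunE scale_lfunE scalerDl scalerA.
Qed.

Lemma tens_linearl v : linear (tens^~ v).
Proof.
move=> a u w; congr (_, _); apply/lfunP => z;
  by rewrite add_lfunE scale_lfunE ?tensXE ?tensX'E scalerDr !scalerA mulrC.
Qed.

Lemma dbasE i x : dbas i x = coord (vbasis {:X}) i x.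
Proof. exact: (lfunE (coord (vbasis {:X}) i : {linear X -> F^o})). Qed.

Lemma bas_sum x : x = \sum_i (dbas i x : F) *: bas i.
Proof.
rewrite {1}(coord_vbasis (memvf x)).
by apply: eq_bigr => i _; rewrite dbasE.
Qed.

Lemma dbas_sum (y : dual X) : y = \sum_i (y (bas i) : F) *: dbas i.
Proof.
apply/lfunP => x; rewrite {1}(bas_sum x) linear_sum sum_lfunE /=.
by apply: eq_bigr => i _; rewrite linearZ scale_lfunE /= /GRing.scale /= mulrC.
Qed.

Lemma prod_basE (v : X * dual X) :
  v = \sum_i ((dbas i v.1 : F) *: (bas i, 0) + (v.2 (bas i) : F) *: (0, dbas i)).
Proof.
have fst_sum I (s : seq I) (f : I -> X * dual X) :
  (\sum_(i <- s) f i).1 = \sum_(i <- s) (f i).1 by exact: (big_morph fst).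
have snd_sum I (s : seq I) (f : I -> X * dual X) :
  (\sum_(i <- s) f i).2 = \sum_(i <- s) (f i).2 by exact: (big_morph snd).
rewrite [LHS]surjective_pairing [RHS]surjective_pairing fst_sum snd_sum.
congr (_, _); [rewrite {1}(bas_sum v.1) | rewrite {1}(dbas_sum v.2)];
  by apply: eq_bigr => i _ /=; rewrite scaler0 ?addr0 ?add0r.
Qed.

Lemma id_tensE S u v : id_tens S (tens u v) = tens u (S v).
Proof.
pose tl (v : (X * dual X)%type) : {linear U -> UV} :=
  HB.pack (fun u => tens u v) (GRing.isLinear.Build _ _ _ _ _ (tens_linearl v)).
pose tr (u : U) : {linear (X * dual X)%type -> UV} :=
  HB.pack (tens u) (GRing.isLinear.Build _ _ _ _ _ (tens_linearr u)).
have tlZ a w z : tens (a *: w) z = a *: tens w z := linearZ_LR (tl z) a w.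
have tlD a b z : tens (a + b) z = tens a z + tens b z := linearD (tl z) a b.
have trZ a w z : tens w (a *: z) = a *: tens w z := linearZ_LR (tr w) a z.
have trD a b z : tens z (a + b) = tens z a + tens z b := linearD (tr z) a b.
pose f (Z : UV) : UV := \sum_i (tens (Z.1 (dbas i)) (S (bas i, 0))
                              + tens (Z.2 (bas i)) (S (0, dbas i))).
have f_lin : linear f.
  move=> a Z W; rewrite /f scaler_sumr -big_split /=; apply: eq_bigr => i _.
  by rewrite !add_lfunE !scale_lfunE !tlD !tlZ scalerDr addrACA.
pose fL : {linear _ -> _} := HB.pack f (GRing.isLinear.Build _ _ _ _ f f_lin).
have trS (g : 'I_(\dim {:X}) -> (X * dual X)%type) :
  tens u (\sum_i g i) = \sum_i tens u (g i) := linear_sum (tr u) _ _ _.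
rewrite [LHS](lfunE fL) /= /f [in RHS](prod_basE v) linear_sum trS.
apply: eq_bigr => i _.
by rewrite /= linearD !linearZ trD !trZ tensXE tensX'E !tlZ.
Qed.

Lemma tens_pairE (beta : {symmetric U}) u x v y :
  tens_pair beta (tensX u x) (tensX' v y) = beta u v * (y x : F).
Proof.
rewrite /tens_pair {2}(bas_sum x) linear_sum mulr_sumr; apply: eq_bigr => i _.
rewrite tensXE tensX'E linearZl_LR linearZr_LR linearZ /= /GRing.scale /=.
by ring.
Qed.

End Tensor.

Section Rank.
Variables (p : nat) (F : finFieldType) (pcharFp : p \in [pchar F]).
Variables (R : realType) (X U : vectType F).
Variable mu : 'End(UV X U) -> 'End(L2 R 'Hom(X, U)).
Variable K : {vspace L2 R 'Hom(X, U)}.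

Definition Sp_subrep : Prop :=
  forall S, symplectic (@eval F X) S -> forall Phi, Phi \in K ->
    mu (id_tens U S) Phi \in K.

Definition N_weight (B : 'Hom(X, dual X)) : Prop :=
  (forall x x', eval x (B x') = eval x' (B x)) /\
  exists Phi, [/\ Phi \in K, Phi != 0 &
    forall A, symmetric_map (@eval F X) A ->
      mu (id_tens U (N_map A)) Phi = omega pcharFp R (lfun_tr (A \o B)%VF) *: Phi].

Definition rep_rank (r : nat) : Prop :=
  (exists2 B, N_weight B & \dim (limg B) = r) /\
  (forall B, N_weight B -> (\dim (limg B) <= r)%N).

End Rank.

Section CSS.
Variables (R : realType) (F : finFieldType) (X U : vectType F).
Variable beta : {symmetric U}.
Local Notation L := (L2 R 'Hom(X, U)).

Definition isotropic (N : {vspace U}) : bool := (N <= orthov beta N)%VS.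

Definition css_code (N : {vspace U}) (Phi : L) : Prop :=
  (forall H : 'Hom(X, U), Phi H != 0 -> (limg H <= orthov beta N)%VS) /\
  (forall H H' : 'Hom(X, U), (limg (H - H') <= N)%VS -> Phi H = Phi H').

Definition css_span (d : nat) (Phi : L) : Prop :=
  exists2 s : seq L,
    (forall Psi, Psi \in s ->
      exists N, [/\ isotropic N, \dim N = d & css_code N Psi]) &
    Phi \in <<s>>%VS.

End CSS.

(* Main.v *)
From HB Require Import structures.
Require Import Defs.
From mathcomp Require Import all_boot all_order all_algebra all_fingroup all_field.
From mathcomp Require Import sesquilinear complex reals trigo boolp.
From mathcomp Require Import ring zify.

(** Two families of operators carry the whole argument.  Multiplying a function
on Hom(X, U) by the phases that mu(N_A) produces for A of rank one, and
averaging, gives the restrictions Lproj to { H | beta (H x) (H x) = c }.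
Conjugating the same phases by the Fourier transform mu(J_B) gives, up to a
scalar, the convolutions

  Lconv l xi Phi (H) = sum over u of psi (l beta(u, u)) Phi (H + u (x) xi).

A subrepresentation K is therefore stable under both (subrep_stable).  Its rank is
the largest rank of a form gram H = H^T H with H in the support of an element of K.

Restrictions cut an element of K down to the set where gram H is a given form B
(restrict_gram).  Suppose that B has the largest possible rank s and let Z be its
radical.  Then the convolutions of the restricted function f also live in rank at
most s, and this is a strong constraint: moving H by v (x) xi raises the rank
unless v is orthogonal to H (Z :&: ker xi), so the inversion formula convK for
convolutions makes f invariant under H |-> H + H z (x) xi for z in Z, xi z = 0 and
xi nonzero on Z (max_rank_translate).  The image H(Z) is isotropic, and
s + 2 dim H(Z) <= dim U.  If H(Z) has the largest dimension among the H in the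
support, equality holds (max_rank_top): otherwise the orthogonal of the image of H
contains an anisotropic u0, the convolution of f vanishes at H + u0 (x) xi because
the rank there exceeds s, and the invariance turns this into f H = 0.  So t - s is
even.

Fix N of dimension (t - s) / 2.  The translations above connect any two H, H' with
H(Z) = H'(Z) = N and H' - H in Hom(X, N) (max_rank_connected).  This takes a nonzero
vector of Z killed by H, which t <= n provides unless N = 0; in that case every
function is in C_N.  Hence f agrees, wherever H(Z) = N, with an element
code_part N f of the code C_N.  Subtracting these for all N leaves a function of the same kind whose support contains no H
with s + 2 dim H(Z) = dim U, that is, zero (max_rank_css).

The parts of K of smaller rank are handled by duality (stable_css).  A code is
contained in the code of any smaller isotropic space, and the span of the codes is
stable under both families of operators, hence so is the orthogonal complement in K
of its intersection W with that span.  If the complement were nonzero, the argument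
above, applied to its own largest rank s <= r, would give it a nonzero element in
codes with dim N = (t - s) / 2 >= (t - r) / 2, hence in W. *)

Set Implicit Arguments.
Unset Strict Implicit.
Unset Printing Implicit Defensive.

Import Order.TTheory GRing.Theory Num.Theory passmx.
Local Open Scope ring_scope.

(** * Subspaces and linear functionals *)
Section Subspaces.

(** A subspace of largest dimension among those on which P holds contains every x
such that P x, since otherwise x could be added to it. *)
Lemma vspace_of_closed (K : fieldType) (V : vectType K) (P : V -> Prop) :
  P 0 -> (forall a x y, P x -> P y -> P (a *: x + y)) ->
  exists W : {vspace V}, forall x, x \in W <-> P x.
Proof.
move=> P0 Plin.
pose dims k := `[< exists2 W : {vspace V}, \dim W = k & forall x, x \in W -> P x >].
have dims0 : exists k, dims k.
  exists 0%N; apply/asboolP; exists 0%VS; first exact: dimv0.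
  by move=> x; rewrite memv0 => /eqP->.
have dimsB k : dims k -> (k <= \dim {:V})%N.
  by move=> /asboolP[W <- _]; apply: dimvS; rewrite subvf.
case: (ex_maxnP dims0 dimsB) => m /asboolP[W dimW WP] maxm.
exists W => x; split=> [|Px]; first exact: WP.
have /maxm : dims (\dim (W + <[x]>)%VS).
  apply/asboolP; exists (W + <[x]>)%VS => // _ /memv_addP[w Ww [_ /vlineP[a ->] ->]].
  by rewrite addrC; apply: Plin => //; apply: WP.
rewrite -dimW => leWx.
have /eqP-> : W == (W + <[x]>)%VS by rewrite eqEdim addvSl.
by apply: (subvP (addvSr _ _)); apply: memv_line.
Qed.

Lemma linfunE (K : fieldType) (V W : vectType K) (f : V -> W) (v : V) :
  linear f -> linfun f v = f v.
Proof.
move=> f_lin.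
pose fL : {linear _ -> _} := HB.pack f (GRing.isLinear.Build _ _ _ _ f f_lin).
exact: (lfunE fL).
Qed.
Variables (F : fieldType) (X : vectType F).

Lemma functional_separates (V : {vspace X}) (z : X) :
  z \notin V -> exists xi : dual X, (forall v, v \in V -> xi v = 0 :> F) /\ xi z = 1 :> F.
Proof.
move=> Vz; pose q : 'End(X) := (\1 - projv V)%VF.
have qV v : v \in V -> q v = 0.
  by move=> Vv; rewrite /q add_lfunE opp_lfunE id_lfunE projv_id ?subrr.
have qz : q z != 0.
  apply: contra Vz; rewrite /q add_lfunE opp_lfunE id_lfunE subr_eq0 => /eqP->.
  exact: memv_proj.
have [i nz] : exists i, dbas i (q z) != 0 :> F.
  apply/existsP; apply: contraNT qz; rewrite negb_exists => /forallP all0.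
  rewrite (bas_sum (q z)) big1 // => i _.
  by have /negPn/eqP-> := all0 i; rewrite scale0r.
pose xi0 : dual X := (dbas i \o q)%VF.
exists ((dbas i (q z) : F)^-1 *: xi0); split=> [v Vv|].
  by rewrite scale_lfunE comp_lfunE (qV v Vv) linear0 /GRing.scale /= mulr0.
by rewrite scale_lfunE comp_lfunE /= /GRing.scale /= mulVf.
Qed.

(** A vector space is not the union of two proper subspaces, here the spaces of
functionals on X / V vanishing at z and at k: up to a scalar, one of xi, zeta,
xi + zeta works, where xi z = 1 and zeta k = 1. *)
Lemma functional_separates2 (V : {vspace X}) (z k : X) :
  z \notin V -> k \notin V ->
  exists xi : dual X, [/\ forall v, v \in V -> xi v = 0 :> F, xi z = 1 :> F & xi k != 0 :> F].
Proof.
move=> Vz Vk; have [xi [xiV xiz]] := functional_separates Vz.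
have [xik|] := eqVneq (xi k : F) 0; last by exists xi.
have [zeta [zetaV zetak]] := functional_separates Vk.
have [zz|nzz] := eqVneq (zeta z : F) 0.
  exists (xi + zeta); split=> [v Vv||]; rewrite !add_lfunE.
  - by rewrite xiV ?zetaV ?addr0.
  - by rewrite xiz [X in _ + X]zz addr0.
  - by rewrite [X in X + _]xik zetak add0r oner_neq0.
exists ((zeta z : F)^-1 *: zeta); split=> [v Vv||].
- by rewrite scale_lfunE (zetaV v Vv) /GRing.scale /= mulr0.
- by rewrite scale_lfunE /GRing.scale /= mulVf.
- by rewrite scale_lfunE zetak /GRing.scale /= mulr1 invr_eq0.
Qed.

End Subspaces.

(** * Orthogonality for a symmetric form *)
Section Orthogonality.
Variables (F : finFieldType) (U : vectType F) (beta : {symmetric U}).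

Lemma betaC u v : beta u v = beta v u.
Proof. by rewrite hermC expr0 mul1r. Qed.

Lemma betaDl u v w : beta (u + v) w = beta u w + beta v w.
Proof. by rewrite linearDl. Qed.

Lemma betaDr u v w : beta w (u + v) = beta w u + beta w v.
Proof. by rewrite linearDr. Qed.

Lemma betaZl a u v : beta (a *: u) v = a * beta u v.
Proof. by rewrite linearZl_LR. Qed.

Lemma betaZr a u v : beta v (a *: u) = a * beta v u.
Proof. by rewrite linearZr_LR. Qed.

Lemma betaNl u v : beta (- u) v = - beta u v.
Proof. by rewrite linearNl. Qed.

Lemma betaNr u v : beta v (- u) = - beta v u.
Proof. by rewrite linearNr. Qed.

Lemma beta0l v : beta 0 v = 0.
Proof. by rewrite linear0l. Qed.

Lemma orthP (W : {vspace U}) u :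
  reflect (forall w, w \in W -> beta u w = 0) (u \in orthov beta W).
Proof. by apply: (iffP mem_orthovP) => H w; apply: H. Qed.

Lemma orthovS (V W : {vspace U}) : (V <= W)%VS -> (orthov beta W <= orthov beta V)%VS.
Proof.
move=> /subvP sVW; apply/subvP => u /orthP oW.
by apply/orthP => v /sVW; apply: oW.
Qed.

Lemma isotropicP (N : {vspace U}) :
  reflect (forall u v, u \in N -> v \in N -> beta u v = 0) (isotropic beta N).
Proof.
apply: (iffP subvP) => [sN u v /sN/orthP|N0 u Nu]; first exact.
by apply/orthP => v; apply: N0.
Qed.

(** Each vector of a basis of W imposes one linear condition on V. *)
Lemma dim_cap_orthov (V W : {vspace U}) :
  (\dim V <= \dim (V :&: orthov beta W) + \dim W)%N.
Proof.
have step (s : seq U) : (\dim V <= \dim (V :&: orthov beta <<s>>) + size s)%N.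
  elim: s => [|u s IHs] /=.
    by rewrite span_nil orthov0 capvf addn0.
  rewrite span_cons; apply: leq_trans IHs _.
  have -> : (orthov beta (<[u]> + <<s>>) = orthov beta <<s>> :&: orthov beta <[u]>)%VS.
    apply/eqP; rewrite eqEsubv; apply/andP; split.
      by rewrite subv_cap !orthovS ?addvSl ?addvSr.
    by rewrite orthovD capvSl capvSr.
  rewrite capvA addnS -addSn leq_add2r.
  by have := leq_dim_orthov1 beta u (V :&: orthov beta <<s>>); case: (\dim _).
by have := step (vbasis W); rewrite (span_basis (vbasisP W)) size_tuple.
Qed.

Hypothesis nd : nondegenerate beta.

(** One inequality counts equations.  For the other, let C be a complement of the
orthogonal of N: a vector of N orthogonal to C is orthogonal to everything, so
dim N <= dim C by dim_cap_orthov. *)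
Lemma dim_orthov (N : {vspace U}) : (\dim N + \dim (orthov beta N) = \dim {:U})%N.
Proof.
apply/eqP; rewrite eqn_leq; apply/andP; split; last first.
  by rewrite addnC; have := dim_cap_orthov fullv N; rewrite capfv.
pose C := ((orthov beta N)^C)%VS.
have -> : \dim {:U} = (\dim C + \dim (orthov beta N))%N.
  by rewrite dimv_compl subnK // dimvS ?subvf.
rewrite leq_add2r; apply: leq_trans (dim_cap_orthov N C) _.
suff -> : (N :&: orthov beta C)%VS = 0%VS by rewrite dimv0.
apply/eqP; rewrite -subv0 -(eqP nd); apply/subvP => u /memv_capP[uN uC].
apply/orthP => v; rewrite -(addv_complf (orthov beta N)).
move=> /memv_addP[a aN [b bC ->]]; rewrite betaDr betaC.
by move/orthP: aN => -> //; move/orthP: uC => -> //; rewrite addr0.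
Qed.

Hypothesis two_neq0 : 2%:R != 0 :> F.

Lemma isotropic_of_square (N : {vspace U}) :
  (forall u, u \in N -> beta u u = 0) -> isotropic beta N.
Proof.
move=> N0; apply/isotropicP => u v Nu Nv.
have := N0 _ (rpredD Nu Nv).
rewrite !(betaDl, betaDr) !N0 // (betaC v u) add0r addr0 -mulr2n -mulr_natl.
by move/eqP; rewrite mulf_eq0 (negPf two_neq0) => /eqP.
Qed.

End Orthogonality.

(** * The form H^T H and rank-one perturbations *)
Section Gram.
Variables (F : finFieldType) (X U : vectType F) (beta : {symmetric U}).
Implicit Types (G H : 'Hom(X, U)).

Definition gram H : 'Hom(X, dual X) :=
  linfun (fun x : X => linfun (fun x' : X => beta (H x) (H x') : F^o) : dual X).

Lemma gramE H x x' : gram H x x' = beta (H x) (H x').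
Proof.
have inner z z' :
    (linfun (fun x'' : X => beta (H z) (H x'') : F^o) : dual X) z' = beta (H z) (H z').
  by rewrite linfunE // => a u v; rewrite linearP betaDr betaZr.
rewrite /gram linfunE ?inner // => a u v; apply/lfunP => z.
by rewrite add_lfunE scale_lfunE !inner linearP betaDl betaZl.
Qed.

Lemma mem_gram_ker H x :
  reflect (forall x', beta (H x) (H x') = 0) (x \in lker (gram H)).
Proof.
rewrite memv_ker; apply: (iffP eqP) => [Hx x'|H0].
  by rewrite -gramE Hx zero_lfunE.
by apply/lfunP => x'; rewrite gramE H0 zero_lfunE.
Qed.

Definition rk H : nat := \dim (limg (gram H)).

Lemma rank_gram H : (rk H + \dim (lker (gram H)) = \dim {:X})%N.
Proof. by rewrite /rk addnC -(limg_ker_dim (gram H) fullv) capfv. Qed.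

Lemma img_gram_ker_orth H : (H @: lker (gram H) <= orthov beta (limg H))%VS.
Proof.
apply/subvP => _ /memv_imgP[z /mem_gram_ker Hz ->].
by apply/orthP => _ /memv_imgP[x _ ->].
Qed.

(** The radical of gram H is the preimage of the orthogonal of the image of H, so
its image lies both in the image of H and in its orthogonal. *)
Lemma isotropic_img_gram_ker H : isotropic beta (H @: lker (gram H)).
Proof.
apply: subv_trans (img_gram_ker_orth H) _.
by apply: orthovS; apply: limgS; apply: subvf.
Qed.

Lemma dim_limg_gram H :
  \dim (limg H) = (rk H + \dim (H @: lker (gram H)))%N.
Proof.
have kerS : (lker H <= lker (gram H))%VS.
  apply/subvP => x; rewrite memv_ker => /eqP Hx.
  by apply/mem_gram_ker => x'; rewrite Hx beta0l.
have := limg_ker_dim H fullv; rewrite capfv -(rank_gram H).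
have := limg_ker_dim H (lker (gram H)); rewrite (capv_idPr kerS); lia.
Qed.

Lemma gram_rank1 H (v : U) (xi : dual X) x x' :
  beta ((H + tensX' v xi) x) ((H + tensX' v xi) x') =
  beta (H x) (H x') + (xi x : F) * beta v (H x') + (xi x' : F) * beta v (H x)
    + (xi x : F) * (xi x' : F) * beta v v.
Proof.
rewrite !add_lfunE !tensX'E !(betaDl, betaDr, betaZl, betaZr) (betaC beta (H x) v).
by ring.
Qed.

(** Let W be the radical after the perturbation.  As xi does not vanish on the old
radical Z, every vector is in Z + ker xi; this forces W :&: ker xi into Z and
makes v orthogonal to its image.  Since the rank does not grow, W :&: ker xi has at
least the dimension of Z :&: ker xi, so the two are equal. *)
Lemma rank_gram_nonincrease H (v : U) (xi : dual X) (y : X) :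
    y \in lker (gram H) -> xi y != 0 :> F ->
    (rk (H + tensX' v xi)%R <= rk H)%N ->
  forall z, z \in lker (gram H) -> xi z = 0 :> F -> beta v (H z) = 0.
Proof.
move=> Zy xiy; set H' := H + tensX' v xi => leH z Zz xiz; pose W := lker (gram H').
have leZW : (\dim (lker (gram H)) <= \dim W)%N.
  have := rank_gram H; have := rank_gram H'; rewrite -/W; lia.
have xkerW x : x \in W -> xi x = 0 :> F ->
    x \in lker (gram H) /\ beta v (H x) = 0.
  move=> /mem_gram_ker Wx xix.
  have Hx x' : beta (H x) (H x') + (xi x' : F) * beta v (H x) = 0.
    by have := Wx x'; rewrite gram_rank1 xix !mul0r !addr0.
  have Hy : beta (H x) (H y) = 0 by rewrite betaC; apply/mem_gram_ker.
  have /eqP : (xi y : F) * beta v (H x) = 0 by rewrite -(Hx y) Hy add0r.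
  rewrite mulf_eq0 (negPf xiy) => /eqP vx; split=> //.
  by apply/mem_gram_ker => x'; have := Hx x'; rewrite vx mulr0 addr0.
have : z \in (lker (gram H) :&: lker xi)%VS by rewrite memv_cap Zz memv_ker; apply/eqP.
suff -> : (lker (gram H) :&: lker xi)%VS = (W :&: lker xi)%VS.
  by move=> /memv_capP[Wz _]; have [] := xkerW z Wz xiz.
apply/esym/eqP; rewrite eqEdim; apply/andP; split.
  apply/subvP => x /memv_capP[Wx]; rewrite memv_ker => /eqP xix.
  by have [Zx _] := xkerW x Wx xix; rewrite memv_cap Zx memv_ker xix eqxx.
have dim_im (T : {vspace X}) : (\dim (xi @: T) <= 1)%N.
  by apply: leq_trans (dimvS (subvf _)) _; rewrite dimvf.
have := limg_ker_dim xi W; have := limg_ker_dim xi (lker (gram H)).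
have := dim_im W.
have : (0 < \dim (xi @: lker (gram H)))%N.
  rewrite lt0n dimv_eq0; apply: contraNneq xiy => im0.
  by rewrite -(memv0 (xi y : F^o)) -im0 memv_img.
lia.
Qed.

(** The new form is gram H + beta(v, v) xi xi; testing it against y shows that its
radical lies in ker xi, hence in a subspace of the old radical that misses y. *)
Lemma rank_gram_increase H (v : U) (xi : dual X) (y : X) :
    v \in orthov beta (limg H) -> beta v v != 0 ->
    y \in lker (gram H) -> xi y != 0 :> F ->
  (rk H < rk (H + tensX' v xi)%R)%N.
Proof.
move=> /orthP oH vv Zy xiy; set H' := H + tensX' v xi.
have vH x : beta v (H x) = 0 by rewrite oH ?memv_img ?memvf.
have ltW : (\dim (lker (gram H')) < \dim (lker (gram H)))%N.
  have sW x : x \in lker (gram H') -> x \in lker (gram H) /\ xi x = 0 :> F.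
    move=> /mem_gram_ker Wx.
    have Hx x' : beta (H x) (H x') + (xi x : F) * (xi x' : F) * beta v v = 0.
      by have := Wx x'; rewrite gram_rank1 !vH !mulr0 !addr0.
    have Hy : beta (H x) (H y) = 0 by rewrite betaC; apply/mem_gram_ker.
    have /eqP := Hx y; rewrite Hy add0r !mulf_eq0 (negPf xiy) (negPf vv) !orbF.
    move=> /eqP xix; split=> //; apply/mem_gram_ker => x'.
    by have := Hx x'; rewrite xix !mul0r addr0.
  rewrite ltn_neqAle dimvS ?andbT; last by apply/subvP => x /sW[].
  apply/negP => eqd.
  have /eqP eqW : lker (gram H') == lker (gram H).
    by rewrite eqEdim -(eqP eqd) leqnn andbT; apply/subvP => x /sW[].
  by move: Zy; rewrite -eqW => /sW[_ xi0]; rewrite xi0 eqxx in xiy.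
have := rank_gram H; have := rank_gram H'; lia.
Qed.

Hypothesis nd : nondegenerate beta.

Lemma dim_gram_isotropic H :
  (rk H + 2 * \dim (H @: lker (gram H)) <= \dim {:U})%N.
Proof.
have := dim_orthov nd (limg H); have := dimvS (img_gram_ker_orth H).
rewrite dim_limg_gram; lia.
Qed.

(** On a code the form gram H factors through the quotient of the orthogonal of N
by N, whose dimension is dim U - 2 dim N. *)
Lemma rank_gram_code (N : {vspace U}) H : isotropic beta N ->
  (limg H <= orthov beta N)%VS ->
  (rk H + 2 * \dim N <= \dim {:U})%N.
Proof.
move=> isoN HN.
have sN : (H @^-1: N <= lker (gram H))%VS.
  apply/subvP => x; rewrite -memv_preim => NHx; apply/mem_gram_ker => x'.
  rewrite betaC; by have /orthP := subvP HN _ (memv_img H (memvf x')); apply.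
have kerS : (lker H <= H @^-1: N)%VS.
  by apply/subvP => x; rewrite memv_ker -memv_preim => /eqP->; rewrite mem0v.
have imN : (H @: (H @^-1: N) = N :&: limg H)%VS.
  apply/eqP; rewrite eqEsubv; apply/andP; split; apply/subvP => u.
    move=> /memv_imgP[x]; rewrite -memv_preim => NHx ->.
    by rewrite memv_cap NHx memv_img ?memvf.
  move=> /memv_capP[Nu /memv_imgP[x _ uE]]; rewrite uE memv_img // -memv_preim -uE.
  exact: Nu.
have := limg_ker_dim H fullv; rewrite capfv -(rank_gram H).
have := limg_ker_dim H (H @^-1: N)%VS; rewrite (capv_idPr kerS) imN.
have := dimv_sum_cap N (limg H); have := dim_orthov nd N.
have : (N + limg H <= orthov beta N)%VS by rewrite subv_add HN andbT; exact: isoN.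
move=> /dimvS; have := dimvS sN; lia.
Qed.

(** By polarization, as 2 is invertible. *)
Lemma gram_eqP G H : 2%:R != 0 :> F ->
  (forall x, beta (G x) (G x) = beta (H x) (H x)) -> gram G = gram H.
Proof.
move=> two_neq0 eqGH; apply/lfunP => x; apply/lfunP => x'; rewrite !gramE.
have := eqGH (x + x'); rewrite !linearD /= !(betaDl, betaDr) !eqGH.
rewrite (betaC beta (G x') (G x)) (betaC beta (H x') (H x)) => eq2.
have : 2%:R * (beta (G x) (G x') - beta (H x) (H x')) = 0.
  apply: etrans (_ : _ = _ - _) (etrans (congr1 (fun c => c - _) eq2) (subrr _)).
  by ring.
by move/eqP; rewrite mulf_eq0 (negPf two_neq0) subr_eq0 => /eqP.
Qed.

End Gram.

(** * Additive characters of a finite field *)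
Section CharacterSums.
Variables (F : finFieldType) (C : numClosedFieldType).

Record additive_character (psi : F -> C) : Prop := AdditiveCharacter {
  char0 : psi 0 = 1;
  charD : forall a b, psi (a + b) = psi a * psi b;
  charN : forall a, psi (- a) = (psi a)^*;
  char_neq1 : exists a, psi a != 1
}.

Lemma sum_translate (V : vectType F) (g : V -> C) (w : V) :
  \sum_(u : finvect_type V) g (u + w : V) = \sum_(u : finvect_type V) g u.
Proof. by rewrite [RHS](reindex_inj (addIr (w : finvect_type V))). Qed.

Lemma sum_subspace_char (V : vectType F) (N : {vspace V}) (chi : V -> C) (w : V) :
  (forall u v, chi (u + v) = chi u * chi v) -> w \in N -> chi w != 1 ->
  \sum_(u : finvect_type V | (u : V) \in N) chi u = 0.
Proof.
move=> chiD Nw chiw; apply/eqP.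
have /eqP := erefl (\sum_(u : finvect_type V | (u : V) \in N) chi u).
rewrite {1}(reindex_inj (addIr (w : finvect_type V))) /=.
under eq_bigl => u do rewrite (rpredDr (u : V) Nw).
under eq_bigr => u _ do rewrite (chiD u w).
rewrite -mulr_suml -subr_eq0 -[X in _ - X]mulr1 -mulrBr mulf_eq0 subr_eq0.
by rewrite (negPf chiw) orbF.
Qed.

Variable psi : F -> C.
Hypothesis psi_char : additive_character psi.

Lemma char_pairing_neq1 (b : F) : b != 0 -> exists c, psi (c * b) != 1.
Proof.
have [a an1] := char_neq1 psi_char => b0.
by exists (a / b); rewrite divfK.
Qed.

Lemma char_unit a : psi a * (psi a)^* = 1.
Proof. by rewrite -(charN psi_char) -(charD psi_char) subrr (char0 psi_char). Qed.

Lemma char_eq0 a : psi a != 0.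
Proof.
apply: contra_eq_neq (char_unit a) => /eqP; rewrite ?negbK => /eqP->.
by rewrite mul0r eq_sym oner_neq0.
Qed.

Lemma char_inj a b : (forall c, psi (c * a) = psi (c * b)) -> a = b.
Proof.
move=> eq_ab; apply/eqP; rewrite -subr_eq0; apply/negPn/negP.
move=> /char_pairing_neq1[c]; rewrite mulrBr (charD psi_char) eq_ab.
by rewrite -(charD psi_char) subrr (char0 psi_char) eqxx.
Qed.

Lemma sum_char (b : F) : \sum_(c : F) psi (c * b) = (#|F| * (b == 0))%:R.
Proof.
have [->|b0] := eqVneq b 0.
  rewrite muln1; under eq_bigr => c _ do rewrite mulr0 (char0 psi_char).
  by rewrite sumr_const.
rewrite muln0; have [c cn1] := char_pairing_neq1 b0.
have /eqP := erefl (\sum_(c : F) psi (c * b)).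
rewrite {1}(reindex_inj (addIr c)) /=.
under eq_bigr => a _ do rewrite mulrDl (charD psi_char).
rewrite -mulr_suml -subr_eq0 -[X in _ - X]mulr1 -mulrBr mulf_eq0 subr_eq0.
by rewrite (negPf cn1) orbF => /eqP.
Qed.

Lemma sum_subspace_beta (U : vectType F) (beta : {symmetric U}) (N : {vspace U})
    (k : F) (u : U) : k != 0 ->
  \sum_(w : finvect_type U | (w : U) \in N) psi (k * beta u w) =
    (#|[pred w : finvect_type U | (w : U) \in N]| * (u \in orthov beta N))%:R.
Proof.
move=> k0; have [/orthP uN|uN] := boolP (u \in orthov beta N).
  rewrite muln1 (eq_bigr (fun => 1)) ?sumr_const // => w Nw.
  by rewrite uN // mulr0 (char0 psi_char).
rewrite muln0; case/mem_orthovPn: uN => w Nw buw.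
have [c cn1] := char_pairing_neq1 (mulf_neq0 k0 buw).
apply: (sum_subspace_char (w := c *: w)).
- by move=> v v'; rewrite betaDr mulrDr (charD psi_char).
- exact: rpredZ.
- by rewrite betaZr mulrCA.
Qed.

End CharacterSums.

(** * Convolution with a quadratic phase along a functional *)
Section Convolution.
Variables (F : finFieldType) (C : numClosedFieldType) (psi : F -> C).
Hypothesis psi_char : additive_character psi.
Variables (X U : vectType F) (beta : {symmetric U}).
Hypothesis nd : nondegenerate beta.
Hypothesis two_neq0 : 2%:R != 0 :> F.
Implicit Types (f : 'Hom(X, U) -> C) (H G : 'Hom(X, U)) (xi : dual X).

(** For l != 0 this is, up to a scalar, the conjugate by a Fourier transform of the
multiplication by a quadratic phase in H x, where x corresponds to xi
(conv_mu_J). *)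
Definition conv (l : F) xi f H : C :=
  \sum_(u : finvect_type U) psi (l * beta (u : U) u) * f (H + tensX' (u : U) xi).

Lemma tensX'D (u v : U) xi : tensX' (u + v) xi = tensX' u xi + tensX' v xi.
Proof. by apply/lfunP => x; rewrite !(add_lfunE, tensX'E) scalerDr. Qed.

Lemma tensX'N (u : U) xi : tensX' (- u) xi = - tensX' u xi.
Proof. by apply/lfunP => x; rewrite !(opp_lfunE, tensX'E) scalerN. Qed.

Lemma conv_translate l xi f H (w : U) :
  conv l xi f (H + tensX' w xi) =
  \sum_(u : finvect_type U) psi (l * beta (u - w : U) (u - w)) * f (H + tensX' (u : U) xi).
Proof.
rewrite -[RHS](sum_translate _ w) /conv; apply: eq_bigr => u _.
by rewrite addrK -addrA -tensX'D [w + _]addrC.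
Qed.

Lemma card_finvect_neq0 (V : vectType F) : #|finvect_type V|%:R != 0 :> C.
Proof.
rewrite pnatr_eq0 -lt0n; apply/card_gt0P; by exists (0 : finvect_type V).
Qed.

(** In the double sum over u and v, shifting u makes the exponent linear in v with
slope -2 l beta(u, .), so only u = 0 survives. *)
Lemma convK l xi f H : l != 0 ->
  conv (- l) xi (conv l xi f) H = #|finvect_type U|%:R * f H.
Proof.
move=> l0; rewrite {1}/conv.
under eq_bigr => v _ do rewrite conv_translate mulr_sumr.
rewrite exchange_big /= (bigD1 (0 : finvect_type U)) //= [X in _ + X]big1 => [|u u0].
  rewrite addr0; have -> : tensX' 0 xi = 0 :> 'Hom(X, U).
    by apply/lfunP => x; rewrite tensX'E zero_lfunE scaler0.
  rewrite addr0 (eq_bigr (fun => f H)) ?sumr_const ?mulr_natl // => v _.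
  rewrite sub0r betaNl betaNr opprK mulrA -(charD psi_char).
  by rewrite mulNr addNr (char0 psi_char) mul1r.
have sum0 : \sum_(v : finvect_type U | (v : U) \in fullv)
    psi ((- (2%:R * l)) * beta (u : U) v) = 0.
  rewrite (sum_subspace_beta psi_char); last by rewrite oppr_eq0 mulf_neq0.
  suff /negPf-> : (u : U) \notin orthov beta fullv by rewrite muln0.
  by rewrite (eqP nd) memv0.
transitivity (psi (l * beta (u : U) u) * f (H + tensX' (u : U) xi) *
  \sum_(v : finvect_type U | (v : U) \in fullv) psi ((- (2%:R * l)) * beta (u : U) v)).
  rewrite mulr_sumr; apply: eq_big => [v|v _]; first by rewrite memvf.
  rewrite mulrA -(charD psi_char) mulrAC -(charD psi_char); congr (psi _ * _).
  rewrite !(betaDl, betaDr, betaNl, betaNr) (betaC beta v u); ring.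
by rewrite sum0 mulr0.
Qed.

(** By convK, f H and f (H + w (x) xi) are the same combination of the values
conv 1 xi f (H + v (x) xi), up to the phases psi (- beta(v, v)) and
psi (- beta(v - w, v - w)), which agree when w is isotropic and orthogonal to v. *)
Lemma translation_invariance f xi H (w : U) :
    (forall v : U, conv 1 xi f (H + tensX' v xi) != 0 -> beta v w = 0) ->
    beta w w = 0 ->
  f (H + tensX' w xi) = f H.
Proof.
move=> conv0 ww; apply: (mulfI (card_finvect_neq0 U)).
rewrite -!(convK xi _ _ (oner_neq0 F)) conv_translate {2}/conv.
apply: eq_bigr => v _; have [->|/conv0 vw] := eqVneq (conv 1 xi f (H + tensX' (v : U) xi)) 0.
  by rewrite !mulr0.
congr (psi (_ * _) * _).
by rewrite !(betaDl, betaDr, betaNl, betaNr) (betaC beta w v) vw ww; ring.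
Qed.

End Convolution.

(** * Functions supported on a form of maximal rank *)
Section MaximalRank.
Variables (F : finFieldType) (C : numClosedFieldType) (psi : F -> C).
Hypothesis psi_char : additive_character psi.
Variables (X U : vectType F) (beta : {symmetric U}).
Hypothesis nd : nondegenerate beta.
Hypothesis two_neq0 : 2%:R != 0 :> F.
Variable B : 'Hom(X, dual X).
Implicit Types (f : 'Hom(X, U) -> C) (H G : 'Hom(X, U)) (xi : dual X).
Local Notation s := (\dim (limg B)).
Local Notation Z := (lker B).
Local Notation tensX' u xi := (tensX' (u : U) (xi : dual X)).

(** The restriction to one form of an element of a stable space has this property
when no element of the space has a form of larger rank in its support. *)
Record max_rank f : Prop := MaxRank {
  supp_gram : forall H, f H != 0 -> gram beta H = B;
  supp_conv : forall xi H, conv psi beta 1 xi f H != 0 -> (rk beta H <= s)%N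
}.

(** rank_gram_nonincrease says that the values of the convolution that matter sit at
v orthogonal to H z, which is the hypothesis of translation_invariance. *)
Lemma max_rank_translate f H xi (y z : X) : max_rank f -> gram beta H = B ->
  y \in Z -> xi y != 0 :> F -> z \in Z -> xi z = 0 :> F ->
  f (H + tensX' (H z) xi) = f H.
Proof.
move=> fB HB Zy xiy Zz xiz; rewrite -HB in Zy Zz.
apply: (translation_invariance psi_char nd two_neq0).
  move=> v /(supp_conv fB); rewrite -HB => le_rk.
  exact: rank_gram_nonincrease Zy xiy le_rk z Zz xiz.
exact: (mem_gram_ker _ _ _ Zz).
Qed.

(** Otherwise there is an anisotropic u0 orthogonal to the image of H, and a nonzero
y in Z with H y = 0.  Choose xi y = 1.  The rank at H + u0 (x) xi exceeds s, so
the convolution vanishes there: a sum over m of phases times f (H + m (x) xi) is 0.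
The terms with m in H(Z) are all equal to the one at m = 0 by invariance; for the
other m the image of Z becomes larger, because y is now sent to m, so they vanish by
hypothesis. *)
Lemma max_rank_top f H : max_rank f -> gram beta H = B ->
    (\dim {:U} <= \dim {:X})%N -> (s + 2 * \dim (H @: Z) < \dim {:U})%N ->
    (forall G, (\dim (H @: Z) < \dim (G @: Z))%N -> f G = 0) ->
  f H = 0.
Proof.
move=> fB HB leUX lt_top f0.
have rkX := rank_gram beta H; have dimH := dim_limg_gram beta H.
rewrite /rk HB in rkX dimH.
pose N := (H @: Z)%VS; pose I := orthov beta (limg H).
have NI : (N <= I)%VS by rewrite /N -HB img_gram_ker_orth.
(* If I were totally isotropic, it would be contained in its own orthogonal, the
   image of H, hence in N, which is too small. *)
have [u0 Iu0 u0u0] : exists2 u0, u0 \in I & beta u0 u0 != 0.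
  have [/existsP[u /andP[Iu uu]]|none] :=
    boolP [exists u : finvect_type U, ((u : U) \in I) && (beta (u : U) u != 0)].
    by exists u.
  have isoI : isotropic beta I.
    apply: (isotropic_of_square two_neq0) => u Iu; apply/eqP.
    move: none; rewrite negb_exists => /forallP/(_ u).
    by rewrite Iu negbK.
  have imI : (limg H <= orthov beta I)%VS.
    apply/subvP => h Hh; apply/orthP => i /orthP Ii; rewrite betaC; exact: Ii.
  have dI := dim_orthov nd (limg H); rewrite -/I in dI.
  have eqI : limg H = orthov beta I.
    by apply/eqP; rewrite eqEdim imI; have := dim_orthov nd I; lia.
  have : (I <= N)%VS.
    apply/subvP => u Iu; have := subvP isoI u Iu; rewrite -eqI => /memv_imgP[x _ uE].
    rewrite uE memv_img // -HB; apply/mem_gram_ker => x'; rewrite -uE.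
    by move/orthP: Iu; apply; rewrite memv_img ?memvf.
  move=> /dimvS; rewrite -/N in dimH lt_top *; lia.
(* dim N < dim Z: otherwise s + 2 dim N >= s + dim Z = dim X >= dim U. *)
have [y [Zy Hy y0]] : exists y, [/\ y \in Z, H y = 0 & y != 0].
  have : (Z :&: lker H)%VS != 0%VS.
    rewrite -dimv_eq0 -lt0n; have := limg_ker_dim H Z; rewrite -/N in lt_top *; lia.
  rewrite -vpick0; set y := vpick _ => y0; exists y.
  have : y \in (Z :&: lker H)%VS by apply: memv_pick.
  by move=> /memv_capP[Zy]; rewrite memv_ker => /eqP Hy.
have [xi [_ xiy]] : exists xi : dual X, (forall v, v \in 0%VS -> xi v = 0 :> F) /\ xi y = 1 :> F.
  by apply: functional_separates; rewrite memv0.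
have xiy0 : xi y != 0 :> F by rewrite xiy oner_neq0.
have conv0 : conv psi beta 1 xi f (H + tensX' u0 xi) = 0.
  have Zy' : y \in lker (gram beta H) by rewrite HB.
  have := rank_gram_increase Iu0 u0u0 Zy' xiy0; rewrite {1}/rk HB ltnNge => lt_s.
  by apply/eqP; apply: contraNT lt_s => /(supp_conv fB).
have : psi (1 * beta u0 u0) * f H * #|[pred u : finvect_type U | (u : U) \in N]|%:R = 0.
  rewrite -[RHS]conv0 conv_translate (bigID (fun u : finvect_type U => (u : U) \in N)) /=.
  rewrite [X in _ = _ + X]big1 => [|m Nm].
    rewrite addr0 mulr_natr -sumr_const; apply: eq_bigr => m Nm; congr (psi (1 * _) * _).
      have /orthP u0H := Iu0; have /orthP mH := subvP NI _ Nm.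
      have mIm : (m : U) \in limg H by apply: (subvP (limgS H (subvf Z))).
      by rewrite !(betaDl, betaDr, betaNl, betaNr) (mH _ mIm) (u0H _ mIm)
         (betaC beta m) (u0H _ mIm); ring.
    move: Nm => /memv_imgP[z Zz ->].
    (* Subtracting a multiple of y moves z into ker xi without changing H z. *)
    have -> : H z = H (z - (xi z : F) *: y) by rewrite linearB linearZ /= Hy scaler0 subr0.
    apply/esym; apply: (max_rank_translate fB HB Zy xiy0).
      by rewrite rpredB // rpredZ.
    by rewrite linearB linearZ /= xiy /GRing.scale /= mulr1 subrr.
  apply/eqP; rewrite mulf_eq0; apply/orP; right; apply/eqP.
  have [//|fm] := eqVneq (f (H + tensX' (m : U) xi)) 0.
  apply: f0.
  have Gy : (H + tensX' (m : U) xi) y = m by rewrite add_lfunE tensX'E Hy add0r xiy scale1r.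
  have Gm : (m : U) \in ((H + tensX' (m : U) xi) @: Z)%VS by rewrite -{1}Gy memv_img.
  have sN : (N <= (H + tensX' (m : U) xi) @: Z)%VS.
    apply/subvP => _ /memv_imgP[z Zz ->].
    rewrite -[H z](addrK ((xi z : F) *: (m : U))) -tensX'E -add_lfunE.
    by rewrite rpredB ?memv_img // tensX'E rpredZ.
  rewrite ltn_neqAle dimvS // andbT; apply: contraNneq Nm => eqd.
  have /eqP -> // : N == ((H + tensX' (m : U) xi) @: Z)%VS.
  by rewrite eqEdim sN eqd leqnn.
move/eqP; rewrite !mulf_eq0 (negPf (char_eq0 psi_char _)) /= pnatr_eq0 => /orP[/eqP//|].
rewrite -leqn0 leqNgt => /negP[]; apply/card_gt0P; exists (0 : finvect_type U).
by rewrite inE mem0v.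
Qed.

Lemma gram_shift (N : {vspace U}) H G : isotropic beta N -> (limg H <= orthov beta N)%VS ->
  (limg G <= N)%VS -> gram beta (H + G) = gram beta H.
Proof.
move=> /isotropicP isoN HN GN; apply/lfunP => x; apply/lfunP => x'.
have GNx z : G z \in N by rewrite (subvP GN) ?memv_img ?memvf.
have HNx z w : w \in N -> beta (H z) w = 0.
  by move=> Nw; have /orthP := subvP HN _ (memv_img H (memvf z)); apply.
rewrite !gramE !add_lfunE !(betaDl, betaDr) (betaC beta (G x) (H x')).
by rewrite (HNx x (G x')) // (HNx x' (G x)) // (isoN (G x) (G x')) // !addr0.
Qed.

Section Connectedness.
Variables (f : 'Hom(X, U) -> C) (N : {vspace U}).
Hypothesis fB : max_rank f.

Let on_N H := gram beta H = B /\ (H @: Z)%VS = N.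

Lemma on_N_isotropic H : on_N H -> isotropic beta N.
Proof. by case=> HB <-; rewrite -HB; apply: isotropic_img_gram_ker. Qed.

Lemma on_N_orth H : on_N H -> (limg H <= orthov beta N)%VS.
Proof.
case=> HB <-; apply/subvP => h Hh; apply/orthP => w Nw; rewrite betaC.
have := img_gram_ker_orth beta H; rewrite HB => /subvP/(_ w Nw)/orthP; exact.
Qed.

(** The vector k lets one write w = H a with a in Z and xi a = 0, and shows in the
same way that N is still the image of Z after the translation. *)
Lemma max_rank_step H (w : U) xi (k : X) : on_N H -> w \in N ->
  k \in Z -> H k = 0 -> xi k != 0 :> F ->
  on_N (H + tensX' w xi) /\ f (H + tensX' w xi) = f H.
Proof.
move=> HN Nw Zk Hk xik; have [HB HZ] := HN.
have adjust n : n \in N -> exists a, [/\ a \in Z, H a = n & xi a = 0 :> F].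
  rewrite -HZ => /memv_imgP[a Za ->]; exists (a - ((xi a : F) / (xi k : F)) *: k).
  split; first by rewrite rpredB // rpredZ.
    by rewrite linearB linearZ /= Hk scaler0 subr0.
  by rewrite linearB linearZ /= /GRing.scale /= divfK // subrr.
have imw : (limg (tensX' w xi) <= N)%VS.
  by apply/subvP => _ /memv_imgP[x _ ->]; rewrite tensX'E rpredZ.
split; last first.
  have [a [Za <- xia]] := adjust w Nw.
  exact: (max_rank_translate fB HB Zk xik Za xia).
split; first by rewrite (gram_shift (on_N_isotropic HN) (on_N_orth HN) imw).
apply/eqP; rewrite eqEsubv; apply/andP; split; apply/subvP => u.
  move=> /memv_imgP[x Zx ->]; rewrite add_lfunE tensX'E rpredD ?rpredZ //.
  by rewrite -HZ memv_img.
move=> /adjust[a [Za <- xia]].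
have -> : H a = (H + tensX' w xi) a by rewrite add_lfunE tensX'E xia scale0r addr0.
exact: memv_img.
Qed.

(** If xi does not vanish at z, the difference of z and a vector of D with the same
image is a vector k as in max_rank_step.  If it does, w (x) xi is the difference of
w (x) (xi + xi0) and w (x) xi0, where xi0 z = 1 and xi0 kills D. *)
Lemma max_rank_step_complement H (w : U) xi (D : {vspace X}) (z : X) :
    (D <= Z)%VS -> z \in Z -> z \notin D ->
    on_N H -> (H @: D)%VS = N -> w \in N -> (forall x, x \in D -> xi x = 0 :> F) ->
  [/\ on_N (H + tensX' w xi), ((H + tensX' w xi) @: D)%VS = N
    & f (H + tensX' w xi) = f H].
Proof.
move=> sDZ Zz Dz.
have imD H1 xi1 w1 : (forall x, x \in D -> xi1 x = 0 :> F) ->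
    ((H1 + tensX' w1 xi1) @: D = H1 @: D)%VS.
  by move=> xi1D; apply: eq_in_limg => x Dx; rewrite add_lfunE tensX'E xi1D // scale0r addr0.
have direct H1 w1 xi1 : on_N H1 -> (H1 @: D)%VS = N -> w1 \in N ->
    (forall x, x \in D -> xi1 x = 0 :> F) -> xi1 z != 0 :> F ->
    on_N (H1 + tensX' w1 xi1) /\ f (H1 + tensX' w1 xi1) = f H1.
  move=> H1N H1D Nw1 xi1D xi1z; have [_ H1Z] := H1N.
  have : H1 z \in (H1 @: D)%VS by rewrite H1D -H1Z memv_img.
  move=> /memv_imgP[d Dd H1zd]; apply: (@max_rank_step _ _ _ (z - d)) => //.
  - by rewrite rpredB // (subvP sDZ).
  - by rewrite linearB /= H1zd subrr.
  - by rewrite linearB /= (xi1D d Dd) [X in X != _]subr0.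
move=> HN HD Nw xiD; rewrite imD // HD.
have [xiz|xiz] := eqVneq (xi z : F) 0; last by have [] := direct H w xi HN HD Nw xiD xiz.
have [xi0 [xi0D xi0z]] := functional_separates Dz.
have xi1D x : x \in D -> (xi + xi0) x = 0 :> F.
  by move=> Dx; rewrite add_lfunE (xiD x Dx) (xi0D x Dx) add0r.
have -> : H + tensX' w xi = H + tensX' w (xi + xi0) + tensX' (- w) xi0.
  apply/lfunP => x; rewrite !(add_lfunE, tensX'E) scalerDl scalerN.
  by rewrite -!addrA subrr addr0.
have [|H1N H1f] := direct H w (xi + xi0) HN HD Nw xi1D.
  by rewrite add_lfunE xi0z [X in X + _]xiz add0r oner_neq0.
have [||||H2N H2f] := direct (H + tensX' w (xi + xi0)) (- w) xi0 H1N.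
- by rewrite imD.
- by rewrite rpredN.
- exact: xi0D.
- by rewrite xi0z oner_neq0.
by split=> //; rewrite H2f.
Qed.

(** H' - H factors through X / D, so it is a sum of rank-one maps w (x) xi with w in N
and xi = 0 on D; max_rank_step_complement adds them one at a time. *)
Lemma max_rank_connected_complement H H' (D : {vspace X}) :
  (D <= Z)%VS -> (\dim D < \dim Z)%N -> on_N H -> (H @: D)%VS = N ->
  (forall x, x \in D -> H x = H' x) -> (limg (H' - H) <= N)%VS -> f H' = f H.
Proof.
move=> sDZ ltDZ HN HD eqD imN.
have /subvPn[z Zz Dz] : ~~ (Z <= D)%VS.
  by apply: contraL ltDZ => /dimvS; rewrite -leqNgt.
pose q : 'End(X) := (\1 - projv D)%VF.
pose xi i : dual X := (dbas i \o q)%VF; pose w i := (H' - H) (bas i).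
have qD x : x \in D -> q x = 0.
  by move=> Dx; rewrite /q add_lfunE opp_lfunE id_lfunE projv_id ?subrr.
have xiD i x : x \in D -> xi i x = 0 :> F.
  by move=> Dx; rewrite /xi comp_lfunE (qD x Dx) linear0.
have Nw i : w i \in N by rewrite (subvP imN) ?memv_img ?memvf.
have H'E : H' = H + \sum_i tensX' (w i) (xi i).
  apply/lfunP => x; rewrite add_lfunE sum_lfunE.
  under eq_bigr => i _ do rewrite tensX'E /xi comp_lfunE /w -linearZ.
  rewrite -linear_sum -bas_sum /q add_lfunE opp_lfunE id_lfunE linearB /=.
  have := memv_proj D x; move: (projv D x) => d Dd.
  by rewrite !add_lfunE !opp_lfunE -(eqD d Dd) subrr subr0 addrC subrK.
rewrite H'E.
suff [_ _ //] : [/\ on_N (H + \sum_i tensX' (w i) (xi i)),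
  ((H + \sum_i tensX' (w i) (xi i)) @: D)%VS = N & f (H + \sum_i tensX' (w i) (xi i)) = f H].
elim/big_rec: _ => [|i G _ [GN GD Gf]]; first by rewrite addr0.
rewrite [_ + G]addrC addrA -Gf.
exact: max_rank_step_complement sDZ Zz Dz GN GD (Nw i) (xiD i).
Qed.

(** Enlarge a subspace D of Z on which H is injective and agrees with H'.  As long as
H(D) <> N there is z in Z with H' z outside H(D); the translation by
(H' z - H z) (x) xi, with xi = 0 on D and xi z = 1, makes H agree with H' at z too.
It is allowed by max_rank_step if moreover xi k != 0 for some k in Z :&: ker H, and
such a k exists because dim N < dim Z.  When H(D) = N,
max_rank_connected_complement concludes. *)
Lemma max_rank_connected H H' : (\dim N < \dim Z)%N -> on_N H -> on_N H' ->
  (limg (H' - H) <= N)%VS -> f H' = f H.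
Proof.
move=> ltNZ HN H'N imN.
have main m (D : {vspace X}) : (\dim Z - \dim D < m)%N ->
    forall H, on_N H -> (limg (H' - H) <= N)%VS -> (D <= Z)%VS ->
    (D :&: lker H)%VS = 0%VS -> (forall x, x \in D -> H x = H' x) -> f H' = f H.
  elim: m D => // m IHm D ltm {imN HN}H HN imN sDZ injD eqD.
  have [HB HZ] := HN; have [H'B H'Z] := H'N.
  have dimD : \dim (H @: D) = \dim D by have := limg_ker_dim H D; rewrite injD dimv0.
  have sHD : (H @: D <= N)%VS by rewrite -HZ limgS.
  have [HD|nHD] := eqVneq (H @: D)%VS N.
    by apply: (max_rank_connected_complement sDZ _ HN HD eqD imN); rewrite -dimD HD.
  have /subvPn[_ /memv_imgP[z Zz ->] DH'z] : ~~ (H' @: Z <= H @: D)%VS.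
    by rewrite H'Z; apply: contra nHD => sND; rewrite eqEsubv sHD.
  have Dz : z \notin D by apply: contra DH'z => Dz; rewrite -eqD // memv_img.
  have [k [Zk Hk k0]] : exists k, [/\ k \in Z, H k = 0 & k != 0].
    have : (Z :&: lker H)%VS != 0%VS.
      by rewrite -dimv_eq0 -lt0n; have := limg_ker_dim H Z; rewrite HZ; clear -ltNZ; lia.
    rewrite -vpick0; set y := vpick _ => y0; exists y.
    have : y \in (Z :&: lker H)%VS by apply: memv_pick.
    by move=> /memv_capP[Zy]; rewrite memv_ker => /eqP Hy.
  have Dk : k \notin D.
    apply: contra k0 => Dk; rewrite -memv0 -injD memv_cap Dk memv_ker; exact/eqP.
  have [xi [xiD xiz xik]] := functional_separates2 Dz Dk.
  pose w := H' z - H z.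
  have Nw : w \in N by rewrite /w -HZ rpredB ?memv_img // HZ -H'Z memv_img.
  have [H1N <-] := max_rank_step HN Nw Zk Hk xik.
  have H1x x : (H + tensX' w xi) x = H x + (xi x : F) *: w by rewrite add_lfunE tensX'E.
  have H1dz d c : d \in D -> (H + tensX' w xi) (d + c *: z) = H d + c *: H' z.
    move=> Dd; have xidz : xi (d + c *: z) = c :> F.
      by rewrite linearD linearZ /= (xiD d Dd) xiz add0r /GRing.scale /= mulr1.
    by rewrite H1x xidz linearD linearZ /= -addrA -scalerDr /w [H z + _]addrC subrK.
  have sD'Z : (D + <[z]> <= Z)%VS by rewrite subv_add sDZ -memvE.
  have ltD : (\dim D < \dim (D + <[z]>))%N.
    rewrite ltn_neqAle dimvS ?addvSl // andbT; apply: contraNneq Dz => eqd.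
    have /eqP -> : D == (D + <[z]>)%VS by rewrite eqEdim addvSl eqd leqnn.
    by rewrite memvE addvSr.
  apply: (IHm (D + <[z]>)%VS) => //.
  - exact: leq_trans (ltn_sub2l (leq_trans ltD (dimvS sD'Z)) ltD) ltm.
  - apply/subvP => _ /memv_imgP[x _ ->]; rewrite opprD addrA add_lfunE opp_lfunE tensX'E.
    by rewrite rpredB ?rpredZ // (subvP imN) ?memv_img ?memvf.
  - apply/eqP; rewrite -subv0; apply/subvP => _ /memv_capP[/memv_addP[d Dd [_ /vlineP[c ->] ->]]].
    rewrite memv_ker H1dz // => Hdz.
    have [c0|c0] := eqVneq c 0.
      move: Hdz; rewrite c0 !scale0r !addr0 => Hd.
      by rewrite -injD memv_cap Dd memv_ker.
    case/negP: DH'z; have -> : H' z = H (- (c^-1 *: d)).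
      apply: (scalerI c0); rewrite linearN linearZ /= scalerN scalerA divff // scale1r.
      by apply/eqP; rewrite -addr_eq0 addrC.
    by rewrite memv_img // rpredN rpredZ.
  - move=> _ /memv_addP[d Dd [_ /vlineP[c ->] ->]].
    by rewrite H1dz // eqD // linearD linearZ.
apply: (main _ 0%VS (ltnSn _) H) => //; first exact: sub0v; first exact: cap0v.
by move=> x; rewrite memv0 => /eqP->; rewrite !linear0.
Qed.

End Connectedness.
End MaximalRank.

Lemma limg_subP (F : fieldType) (X U : vectType F) (H : 'Hom(X, U)) (N : {vspace U}) :
  reflect (forall x, H x \in N) (limg H <= N)%VS.
Proof.
apply: (iffP subvP) => [HN x|HN _ /memv_imgP[x _ ->]]; last exact: HN.
by apply: HN; rewrite memv_img ?memvf.
Qed.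

(** * Spans of codes *)
Section CodeSpans.
Variables (F : finFieldType) (R : realType) (psi : F -> R[i]).
Hypothesis psi_char : additive_character psi.
Variables (X U : vectType F) (beta : {symmetric U}).
Hypothesis nd : nondegenerate beta.
Hypothesis two_neq0 : 2%:R != 0 :> F.
Local Notation L := (L2 R 'Hom(X, U)).
Implicit Types (Phi Psi : L) (H G : 'Hom(X, U)) (xi : dual X).

(** The values of an element of L2 lie in the regular module over R[i]; vals reads
them as scalars, so that ring operations on them are found. *)
Definition vals Phi H : R[i] := Phi H.

Lemma valsP a Phi Psi H : vals (a *: Phi + Psi) H = a * vals Phi H + vals Psi H.
Proof. by rewrite /vals !ffunE. Qed.

Lemma valsZ a Phi H : vals (a *: Phi) H = a * vals Phi H.
Proof. by rewrite /vals !ffunE. Qed.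

Lemma vals0 H : vals 0 H = 0.
Proof. by rewrite /vals ffunE. Qed.

Lemma valsB Phi Psi H : vals (Phi - Psi) H = vals Phi H - vals Psi H.
Proof. by rewrite /vals !ffunE. Qed.

Lemma vals_sum I (r : seq I) (P : pred I) (Phi : I -> L) H :
  vals (\sum_(i <- r | P i) Phi i) H = \sum_(i <- r | P i) vals (Phi i) H.
Proof. by apply: (big_morph (vals^~ H)) => [? ?|]; rewrite /vals !ffunE. Qed.

Lemma eq_vals Phi Psi : (forall H, vals Phi H = vals Psi H) -> Phi = Psi.
Proof. by move=> eqPP; apply/ffunP => H; apply: eqPP. Qed.

Lemma vals_neq0 Phi : Phi != 0 -> exists H, vals Phi H != 0.
Proof.
move=> Phi0; apply/not_existsP => none; case/eqP: Phi0; apply: eq_vals => H.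
by rewrite vals0; apply/eqP/negPn/negP => /none.
Qed.

Definition of_vals (f : 'Hom(X, U) -> R[i]) : L :=
  [ffun H : finvect_type 'Hom(X, U) => f H].

Lemma of_valsE f H : vals (of_vals f) H = f H.
Proof. by rewrite /vals ffunE. Qed.

Definition Lconv l xi Phi : L := of_vals (conv psi beta l xi (vals Phi)).

Lemma Lconv_vals l xi Phi H : vals (Lconv l xi Phi) H = conv psi beta l xi (vals Phi) H.
Proof. exact: of_valsE. Qed.

Lemma LconvP l xi a Phi Psi :
  Lconv l xi (a *: Phi + Psi) = a *: Lconv l xi Phi + Lconv l xi Psi.
Proof.
apply: eq_vals => H; rewrite valsP !Lconv_vals /conv mulr_sumr -big_split /=.
by apply: eq_bigr => u _; rewrite valsP mulrDr mulrCA.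
Qed.

(** Summing over the translates of u by N, which leave Phi invariant, brings out the
character sum of w |-> psi (2 l beta(u, w)) over N and so keeps only the u orthogonal
to N. *)
Lemma css_code_conv N l xi Phi : isotropic beta N -> l != 0 -> css_code beta N Phi ->
  css_code beta N (Lconv l xi Phi).
Proof.
move=> /isotropicP isoN l0 [sPhi cPhi].
pose cN : R[i] := #|[pred w : finvect_type U | (w : U) \in N]|%:R.
have cN0 : cN != 0.
  rewrite pnatr_eq0 -lt0n; apply/card_gt0P; exists (0 : finvect_type U).
  by rewrite inE mem0v.
have transN H G : (limg G <= N)%VS -> vals Phi (H + G) = vals Phi H.
  by move=> GN; apply: cPhi; rewrite addrC addKr.
have imw (w : U) : w \in N -> (limg (tensX' w xi) <= N)%VS.
  by move=> Nw; apply/limg_subP => x; rewrite tensX'E rpredZ.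
have convE H : vals (Lconv l xi Phi) H =
    \sum_(u : finvect_type U | (u : U) \in orthov beta N)
      psi (l * beta (u : U) u) * vals Phi (H + tensX' (u : U) xi).
  rewrite Lconv_vals; apply: (mulfI cN0).
  transitivity (\sum_(w : finvect_type U | (w : U) \in N) \sum_(u : finvect_type U)
      psi (l * beta (u : U) u) * vals Phi (H + tensX' (u : U) xi)
        * psi (2%:R * l * beta (u : U) w)).
    rewrite {1}/cN -sumr_const mulr_suml; apply: eq_big => [w|w Nw]; first by rewrite inE.
    rewrite inE in Nw; rewrite mul1r /conv -[LHS](sum_translate _ w); apply: eq_bigr => u _.
    rewrite tensX'D addrA (transN _ _ (imw w Nw)) [RHS]mulrAC -(charD psi_char); congr (psi _ * _).
    by rewrite !(betaDl, betaDr) (isoN w w) // (betaC beta w u); ring.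
  rewrite exchange_big /= mulr_sumr [RHS]big_mkcond; apply: eq_bigr => u _.
  rewrite -mulr_sumr (sum_subspace_beta psi_char) ?mulf_neq0 // natrM -/cN.
  by case: (_ \in orthov _ _); rewrite ?mulr1 ?mulr0 // mulrC.
split=> [H|H H' HH'].
  rewrite -/(vals _ H) convE => /eqP; apply: contra_notT => HN.
  rewrite big1 // => u uN; apply/eqP; rewrite mulf_eq0; apply/orP; right.
  apply: contraNT HN => /sPhi /limg_subP HuN; apply/limg_subP => x.
  have := HuN x; rewrite add_lfunE tensX'E => HxN.
  by rewrite -[H x](addrK ((xi x : F) *: (u : U))) rpredB ?rpredZ.
rewrite -!/(vals _ _) !Lconv_vals; apply: eq_bigr => u _; congr (_ * _).
by rewrite -(transN (H' + tensX' (u : U) xi) _ HH'); congr vals; rewrite addrAC [H' + _]addrC subrK.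
Qed.

Definition Lproj (x : X) (c : F) Phi : L :=
  of_vals (fun H => if beta (H x) (H x) == c then vals Phi H else 0).

Lemma Lproj_vals x c Phi H :
  vals (Lproj x c Phi) H = if beta (H x) (H x) == c then vals Phi H else 0.
Proof. exact: of_valsE. Qed.

Lemma LprojP x c a Phi Psi :
  Lproj x c (a *: Phi + Psi) = a *: Lproj x c Phi + Lproj x c Psi.
Proof.
apply: eq_vals => H; rewrite valsP !Lproj_vals valsP.
by case: ifP; rewrite ?mulr0 ?addr0.
Qed.

Lemma css_code_proj N x c Phi : isotropic beta N -> css_code beta N Phi ->
  css_code beta N (Lproj x c Phi).
Proof.
move=> /isotropicP isoN [sPhi cPhi]; split=> [H|H H' HH'].
  rewrite -/(vals _ H) Lproj_vals; case: ifP => _; last by rewrite eqxx.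
  exact: sPhi.
rewrite -!/(vals _ _) !Lproj_vals; have PhiHH' : vals Phi H = vals Phi H' by exact: cPhi.
rewrite PhiHH'; have [->|/sPhi /limg_subP H'N] := eqVneq (vals Phi H') 0.
  by rewrite !if_same.
have -> // : beta (H x) (H x) = beta (H' x) (H' x).
have Nx : (H - H') x \in N by apply/limg_subP.
have -> : H x = H' x + (H - H') x by rewrite add_lfunE opp_lfunE addrC subrK.
have /orthP H'xN := H'N x.
by rewrite !(betaDl, betaDr) (betaC beta ((H - H') x) (H' x)) !(H'xN _ Nx) (isoN _ _ Nx Nx) !addr0.
Qed.

Lemma css_span0 d : css_span beta d (0 : L).
Proof. by exists [::] => //; rewrite mem0v. Qed.

Lemma css_spanP d a Phi Psi : css_span beta d Phi -> css_span beta d Psi ->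
  css_span beta d (a *: Phi + Psi).
Proof.
move=> [s1 s1code s1Phi] [s2 s2code s2Psi]; exists (s1 ++ s2).
  by move=> Xi; rewrite mem_cat => /orP[/s1code|/s2code].
by rewrite span_cat memv_add // rpredZ.
Qed.

Lemma css_span_sum d (I : eqType) (r : seq I) (Phi : I -> L) :
  (forall i, i \in r -> css_span beta d (Phi i)) -> css_span beta d (\sum_(i <- r) Phi i).
Proof.
elim: r => [|i r IHr] rcode; first by rewrite big_nil; apply: css_span0.
rewrite big_cons -[Phi i]scale1r; apply: css_spanP; first by apply: rcode; rewrite mem_head.
by apply: IHr => j rj; apply: rcode; rewrite inE rj orbT.
Qed.

Lemma css_code_span N Phi : isotropic beta N -> css_code beta N Phi ->
  css_span beta (\dim N) Phi.
Proof.
move=> isoN cPhi; exists [:: Phi]; last by rewrite span_seq1 memv_line.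
by move=> Psi; rewrite inE => /eqP->; exists N.
Qed.

Lemma css_span_stable (T : L -> L) d Phi :
  (forall a Phi Psi, T (a *: Phi + Psi) = a *: T Phi + T Psi) ->
  (forall N Psi, isotropic beta N -> css_code beta N Psi -> css_code beta N (T Psi)) ->
  css_span beta d Phi -> css_span beta d (T Phi).
Proof.
move=> TP Tcode [s scode sPhi].
have PhiE := @coord_span _ _ _ (in_tuple s) _ sPhi.
have T0 : T 0 = 0.
  by have := TP (-1) 0 0; rewrite scaler0 addr0 scaleN1r addNr.
have Tsum (r : seq 'I_(size s)) (c : 'I_(size s) -> R[i]) :
    T (\sum_(i <- r) c i *: s`_i) = \sum_(i <- r) c i *: T s`_i.
  elim: r => [|i r IHr]; first by rewrite !big_nil T0.
  by rewrite !big_cons TP IHr.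
rewrite PhiE Tsum; apply: css_span_sum => i _.
have [N [isoN <- cN]] := scode s`_i (mem_nth _ (ltn_ord i)).
rewrite -[_ *: _]addr0; apply: css_spanP; last exact: css_span0.
exact: css_code_span (Tcode _ _ isoN cN).
Qed.

Lemma css_code_sub (N N' : {vspace U}) Phi : (N' <= N)%VS -> css_code beta N Phi ->
  css_code beta N' Phi.
Proof.
move=> sN'N [sPhi cPhi]; split=> [H /sPhi HN|H H' HH']; last exact: cPhi (subv_trans HH' sN'N).
exact: subv_trans HN (orthovS beta sN'N).
Qed.

(** A code is contained in the code of each subspace of N, by css_code_sub. *)
Lemma css_span_mono d d' Phi : (d' <= d)%N -> css_span beta d Phi -> css_span beta d' Phi.
Proof.
move=> led [s scode sPhi]; exists s => // Psi /scode[N [isoN dimN cN]].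
pose N' := <<take d' (vbasis N)>>%VS.
have sN'N : (N' <= N)%VS.
  by apply/span_subvP => v /mem_take; apply: vbasis_mem.
exists N'; split; last exact: css_code_sub sN'N cN.
  exact: subv_trans sN'N (subv_trans isoN (orthovS beta sN'N)).
have freeN' : free (take d' (vbasis N)).
  have := basis_free (vbasisP N); rewrite -{1}[tval (vbasis N)](cat_take_drop d') cat_free.
  by case/and3P.
by rewrite (eqP freeN') size_takel // size_tuple dimN.
Qed.

(** * Functions of maximal rank are sums of codewords *)
Section MaximalRankCodes.
Variable B : 'Hom(X, dual X).
Hypothesis leUX : (\dim {:U} <= \dim {:X})%N.
Local Notation Z := (lker B).
Local Notation s := (\dim (limg B)).

Let Lmax Phi := max_rank psi beta B (vals Phi).

Lemma max_rankP a Phi Psi : Lmax Phi -> Lmax Psi -> Lmax (a *: Phi + Psi).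
Proof.
move=> [gPhi rPhi] [gPsi rPsi]; split=> [H|xi H].
  rewrite valsP; have [Psi0|/gPsi //] := eqVneq (vals Psi H) 0.
  by rewrite Psi0 addr0 mulf_eq0 negb_or => /andP[_ /gPhi].
rewrite -Lconv_vals LconvP valsP !Lconv_vals.
have [Psi0|/rPsi //] := eqVneq (conv psi beta 1 xi (vals Psi) H) 0.
by rewrite Psi0 addr0 mulf_eq0 negb_or => /andP[_ /rPhi].
Qed.

Lemma max_rank0 : Lmax 0.
Proof.
split=> [H|xi H]; first by rewrite vals0 eqxx.
by rewrite /conv big1 ?eqxx // => u _; rewrite vals0 mulr0.
Qed.

(** Take G in the support with dim G(Z) largest and apply max_rank_top. *)
Lemma max_rank_exists_top Phi H : Lmax Phi -> vals Phi H != 0 ->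
  exists G, vals Phi G != 0 /\ (s + 2 * \dim (G @: Z) = \dim {:U})%N.
Proof.
move=> maxPhi PhiH.
pose supp := fun G : finvect_type 'Hom(X, U) => vals Phi G != 0.
pose dimZ := fun G : finvect_type 'Hom(X, U) => \dim ((G : 'Hom(X, U)) @: Z).
case: (@arg_maxnP _ (H : finvect_type 'Hom(X, U)) supp dimZ PhiH) => G suppG maxG.
exists G; split=> //; have GB := supp_gram maxPhi suppG.
have := dim_gram_isotropic nd G; rewrite /rk GB leq_eqVlt => /orP[/eqP //|lt_top].
case/eqP: (suppG); apply: (max_rank_top psi_char nd two_neq0 maxPhi GB leUX lt_top) => G' ltG'.
apply/eqP; apply: contraLR ltG' => /maxG; by rewrite -leqNgt.
Qed.

Let on_N (N : {vspace U}) H := (gram beta H == B) && ((H @: Z)%VS == N).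

(** The extension to H + Hom(X, N) of the values of Phi at the G with G(Z) = N.  The
choice of G is immaterial by max_rank_connected (lemma code_part_eq). *)
Definition code_part (N : {vspace U}) Phi : L :=
  of_vals (fun H =>
    if [pick G : finvect_type 'Hom(X, U) |
         on_N N G && (limg (H - (G : 'Hom(X, U))) <= N)%VS] is Some G
    then vals Phi G else 0).

Lemma code_part_eq (N : {vspace U}) Phi H G : Lmax Phi -> (\dim N < \dim Z)%N ->
  on_N N G -> (limg (H - G) <= N)%VS -> vals (code_part N Phi) H = vals Phi G.
Proof.
move=> maxPhi ltNZ GN HG; rewrite of_valsE; case: pickP => [G' /andP[G'N HG']|none]; last first.
  by have := none G; rewrite GN HG.
have /andP[/eqP GB /eqP GZ] := GN; have /andP[/eqP G'B /eqP G'Z] := G'N.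
apply: (max_rank_connected psi_char nd two_neq0 maxPhi ltNZ) => //.
have -> : (G' : 'Hom(X, U)) - G = (H - G) - (H - (G' : 'Hom(X, U)))
  by rewrite opprB addrCA [H - G]addrC addrK.
apply/limg_subP => x; rewrite add_lfunE opp_lfunE.
by move/limg_subP: HG => HG; move/limg_subP: HG' => HG'; apply: rpredB.
Qed.

Lemma code_part_supp (N : {vspace U}) Phi H : vals (code_part N Phi) H != 0 ->
  exists2 G : 'Hom(X, U), on_N N G & (limg (H - G) <= N)%VS.
Proof.
rewrite of_valsE; case: pickP => [G /andP[GN HG] _|_]; last by rewrite eqxx.
by exists G.
Qed.

Lemma on_N_code (N : {vspace U}) H G : on_N N G -> (limg (H - G) <= N)%VS ->
  [/\ isotropic beta N, (limg H <= orthov beta N)%VS & gram beta H = B].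
Proof.
move=> /andP[/eqP GB /eqP GZ] HG.
have isoN : isotropic beta N by apply: (on_N_isotropic (B := B)) (conj GB GZ).
have oG : (limg G <= orthov beta N)%VS by apply: (on_N_orth (B := B)) (conj GB GZ).
have HE : H = G + (H - G) by rewrite addrC subrK.
split=> //; last by rewrite HE (gram_shift isoN oG HG).
rewrite HE; apply/limg_subP => x; rewrite add_lfunE rpredD //.
  by move/limg_subP: oG; apply.
by apply: (subvP isoN); move/limg_subP: HG; apply.
Qed.

Lemma code_part_code (N : {vspace U}) Phi : Lmax Phi -> (\dim N < \dim Z)%N ->
  css_code beta N (code_part N Phi).
Proof.
move=> maxPhi ltNZ; split=> [H|H H' HH'].
  by move=> /code_part_supp[G GN HG]; have [] := on_N_code GN HG.
have shift H1 H2 G : (limg (H1 - H2) <= N)%VS -> (limg (H2 - G) <= N)%VS -> (limg (H1 - G) <= N)%VS.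
  move=> /limg_subP H12 /limg_subP H2G; apply/limg_subP => x.
  by rewrite -[H1](subrK H2) -addrA add_lfunE rpredD.
have H'H : (limg (H' - H) <= N)%VS.
  by apply/limg_subP => x; rewrite -opprB opp_lfunE rpredN; apply/limg_subP.
rewrite -!/(vals _ _).
have [PhiH|/code_part_supp[G GN HG]] := eqVneq (vals (code_part N Phi) H) 0; last first.
  by rewrite !(@code_part_eq N Phi _ G) //; apply: shift HG.
have [->|/code_part_supp[G GN H'G]] := eqVneq (vals (code_part N Phi) H') 0; first by [].
by rewrite !(@code_part_eq N Phi _ G) //; apply: shift H'G.
Qed.

(** The convolution of an element of C_N stays in C_N, where the rank is at most
dim U - 2 dim N = s by rank_gram_code. *)
Lemma code_part_max (N : {vspace U}) Phi : Lmax Phi -> (\dim N < \dim Z)%N ->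
  isotropic beta N -> (s + 2 * \dim N = \dim {:U})%N -> Lmax (code_part N Phi).
Proof.
move=> maxPhi ltNZ isoN dimN; split=> [H /code_part_supp[G GN HG]|xi H].
  by have [] := on_N_code GN HG.
have [codeS _] := css_code_conv xi isoN (oner_neq0 F) (code_part_code maxPhi ltNZ).
rewrite -Lconv_vals => /codeS HN; have := rank_gram_code nd isoN HN.
by rewrite -dimN leq_add2r.
Qed.

(** Subtract from Phi all its code parts for N of the dimension d that
max_rank_exists_top produces.  At an H with dim H(Z) = d, only the part for
N = H(Z) is nonzero and it equals Phi H; so the difference, which has maximal
rank again, vanishes at all such H, and max_rank_exists_top makes it zero. *)
Lemma max_rank_css Phi H : Lmax Phi -> vals Phi H != 0 ->
  [/\ (s <= \dim {:U})%N, ~~ odd (\dim {:U} - s) & css_span beta (\dim {:U} - s)./2 Phi].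
Proof.
move=> maxPhi PhiH.
have [G0 [PhiG0 dimG0]] := max_rank_exists_top maxPhi PhiH.
set d := \dim (G0 @: Z) in dimG0.
have tsE : (\dim {:U} - s = d.*2)%N by rewrite -dimG0 addKn mul2n.
rewrite tsE odd_double doubleK; split=> //; first by rewrite -dimG0 leq_addr.
(* Every function is in the code of the zero space; this covers Z = 0. *)
have [d0|d_gt0] := posnP d.
  suff code0 : css_code beta 0%VS Phi.
    by have := css_code_span (sub0v _) code0; rewrite dimv0 d0.
  split=> [H1 _|H1 H2]; first by rewrite orthov0 subvf.
  move=> /limg_subP H12; congr (Phi _); apply/lfunP => x; apply/eqP.
  by rewrite -subr_eq0 -opp_lfunE -add_lfunE -memv0.
(* 2 d = dim U - s <= dim X - s = dim Z, and d > 0. *)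
have ltdZ : (d < \dim Z)%N.
  have := limg_ker_dim B fullv; rewrite capfv; move: leUX dimG0 d_gt0; clear; lia.
pose Ns := undup [seq ((G : 'Hom(X, U)) @: Z)%VS | G <- enum (finvect_type 'Hom(X, U))
  & (gram beta (G : 'Hom(X, U)) == B) && (\dim ((G : 'Hom(X, U)) @: Z) == d)].
have NsP N : N \in Ns -> exists2 G, on_N N G & \dim N = d.
  rewrite mem_undup => /mapP[G]; rewrite mem_filter => /andP[/andP[GB dG] _] ->.
  by exists G; [rewrite /on_N GB eqxx | apply/eqP].
have NsI (G : 'Hom(X, U)) : gram beta G = B -> \dim (G @: Z) = d -> (G @: Z)%VS \in Ns.
  move=> GB dG; rewrite mem_undup; apply/mapP; exists (G : finvect_type 'Hom(X, U)) => //.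
  by rewrite mem_filter GB dG !eqxx; have := mem_enum (finvect_type 'Hom(X, U)) G.
have NsIso N : N \in Ns -> isotropic beta N.
  move=> /NsP[G GN _]; have [] // := @on_N_code N G G GN.
  by apply/limg_subP => x; rewrite subrr zero_lfunE mem0v.
pose Psi := \sum_(N <- Ns) code_part N Phi.
have Psicode : css_span beta d Psi.
  apply: css_span_sum => N NN; have [_ _ <-] := NsP N NN.
  apply: css_code_span (NsIso N NN) _; apply: code_part_code => //.
  by have [_ _ ->] := NsP N NN.
have Psimax : Lmax Psi.
  rewrite /Psi big_seq; elim/big_ind: _ => [|Phi1 Phi2 max1 max2|N NN].
  - exact: max_rank0.
  - by rewrite -[Phi1]scale1r; apply: max_rankP.
  have [_ _ dN] := NsP N NN.
  by apply: code_part_max => //; rewrite ?dN //; apply: NsIso.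
suff -> : Phi = Psi by [].
apply/eqP; rewrite -subr_eq0; apply/negPn/negP => /vals_neq0[H1 nz].
have maxD : Lmax (Phi - Psi) by rewrite addrC -scaleN1r; apply: max_rankP.
have [G [PsiG dimG]] := max_rank_exists_top maxD nz.
have GB := supp_gram maxD PsiG.
have dG : \dim (G @: Z) = d by move: dimG dimG0; clear; lia.
case/eqP: PsiG; rewrite valsB vals_sum.
rewrite (bigD1_seq (G @: Z)%VS) ?undup_uniq ?NsI //= big_seq_cond big1 => [|N /andP[NN neN]].
  rewrite addr0 (@code_part_eq _ _ _ G) ?subrr ?dG //; first by rewrite /on_N GB !eqxx.
  by apply/limg_subP => x; rewrite zero_lfunE mem0v.
apply/eqP; apply: contraNT neN => /code_part_supp[G' G'N GG'].
have [_ _ dN] := NsP N NN; rewrite eq_sym eqEdim dG dN leqnn andbT.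
have /andP[_ /eqP G'Z] := G'N.
apply/subvP => _ /memv_imgP[z Zz ->]; rewrite -[G](subrK G') add_lfunE rpredD //.
  by move/limg_subP: GG'; apply.
by rewrite -G'Z memv_img.
Qed.

End MaximalRankCodes.
End CodeSpans.

(** * Spaces stable under restrictions and convolutions *)
Section InvariantSubspaces.
Variables (F : finFieldType) (R : realType) (psi : F -> R[i]).
Hypothesis psi_char : additive_character psi.
Variables (X U : vectType F) (beta : {symmetric U}).
Hypothesis nd : nondegenerate beta.
Hypothesis two_neq0 : 2%:R != 0 :> F.
Local Notation L := (L2 R 'Hom(X, U)).
Implicit Types (Phi Psi : L) (H G : 'Hom(X, U)) (xi : dual X).

Definition dotL Phi Psi : R[i] :=
  \sum_(H : finvect_type 'Hom(X, U)) vals Phi H * (vals Psi H)^*.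

Lemma dotL_linear a Phi Phi' Psi :
  dotL (a *: Phi + Phi') Psi = a * dotL Phi Psi + dotL Phi' Psi.
Proof.
rewrite /dotL mulr_sumr -big_split /=; apply: eq_bigr => H _.
by rewrite valsP mulrDl mulrA.
Qed.

Lemma dotLC Phi Psi : dotL Psi Phi = (dotL Phi Psi)^*.
Proof.
rewrite /dotL rmorph_sum; apply: eq_bigr => H _.
by rewrite rmorphM /= conjCK mulrC.
Qed.

Lemma dotL_eq0 Phi : dotL Phi Phi = 0 -> Phi = 0.
Proof.
move=> /eqP; rewrite psumr_eq0 => [/allP all0|H _]; last by rewrite mul_conjC_ge0.
apply: eq_vals => H; rewrite vals0; apply/eqP; rewrite -mul_conjC_eq0.
by apply: (all0 (H : finvect_type 'Hom(X, U))); rewrite mem_index_enum.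
Qed.

Lemma dotL_conv l xi Phi Psi :
  dotL (Lconv psi beta l xi Phi) Psi = dotL Phi (Lconv psi beta (- l) xi Psi).
Proof.
rewrite /dotL.
under eq_bigr => H _ do rewrite Lconv_vals /conv mulr_suml.
under [RHS]eq_bigr => H _ do rewrite Lconv_vals /conv rmorph_sum mulr_sumr.
rewrite exchange_big [RHS]exchange_big /= [RHS](reindex_inj oppr_inj) /=.
apply: eq_bigr => u _.
rewrite -[RHS](sum_translate (fun H : 'Hom(X, U) => vals Phi H *
  (psi (- l * beta (- (u : U)) (- (u : U))) * vals Psi (H + tensX' (- (u : U)) xi))^*)
  (tensX' (u : U) xi)).
apply: eq_bigr => H _; rewrite tensX'N addrK rmorphM /= -(charN psi_char).
by rewrite betaNl betaNr !mulNr !opprK mulrA [_ * vals Phi _]mulrC.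
Qed.

Lemma dotL_proj x c Phi Psi :
  dotL (Lproj beta x c Phi) Psi = dotL Phi (Lproj beta x c Psi).
Proof.
rewrite /dotL; apply: eq_bigr => H _; rewrite !Lproj_vals.
by case: ifP; rewrite // rmorph0 mulr0 mul0r.
Qed.

(** A predicate rather than a subspace, because it is applied both to K and to the
orthogonal complement of its code part. *)
Record stable (P : L -> Prop) : Prop := Stable {
  stable_conv : forall l xi Phi, l != 0 -> P Phi -> P (Lconv psi beta l xi Phi);
  stable_proj : forall x c Phi, P Phi -> P (Lproj beta x c Phi)
}.

(** By polarization, finitely many restrictions, one for each x, fix the whole form. *)
Lemma restrict_gram (P : L -> Prop) Phi H : stable P -> P Phi -> vals Phi H != 0 ->
  exists Psi, [/\ P Psi, vals Psi H != 0
    & forall G, vals Psi G != 0 -> gram beta G = gram beta H].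
Proof.
move=> stP PPhi PhiH.
have restrict (r : seq X) : exists Psi, [/\ P Psi, vals Psi H != 0 &
    forall G x, x \in r -> vals Psi G != 0 -> beta (G x) (G x) = beta (H x) (H x)].
  elim: r => [|x r [Psi [PPsi PsiH PsiG]]].
    by exists Phi; split=> [||G x]; rewrite ?in_nil.
  exists (Lproj beta x (beta (H x) (H x)) Psi); split.
  - exact: (stable_proj stP).
  - by rewrite Lproj_vals ifT; [exact: PsiH | exact/eqP].
  move=> G y; rewrite Lproj_vals inE; case: ifP => [/eqP Gx|_]; last by rewrite eqxx.
  by case/orP => [/eqP->|ry]; [rewrite Gx | apply: PsiG].
have [Psi [PPsi PsiH PsiG]] := restrict (enum (finvect_type X)).
exists Psi; split=> // G PsiG0; apply: gram_eqP => // x.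
by apply: PsiG => //; have := mem_enum (finvect_type X) x.
Qed.

Lemma max_rank_of_stable (P : L -> Prop) Phi H : stable P -> P Phi -> vals Phi H != 0 ->
  (forall Psi G, P Psi -> vals Psi G != 0 -> (rk beta G <= rk beta H)%N) ->
  exists Psi, [/\ P Psi, vals Psi H != 0 & max_rank psi beta (gram beta H) (vals Psi)].
Proof.
move=> stP PPhi PhiH maxH.
have [Psi [PPsi PsiH PsiG]] := restrict_gram stP PPhi PhiH.
exists Psi; split=> //; split=> // xi G; rewrite -Lconv_vals => nz.
by apply: maxH nz; apply: (stable_conv stP) => //; apply: oner_neq0.
Qed.

Lemma exists_orthogonal (K W : {vspace L}) : ~~ (K <= W)%VS -> (W <= K)%VS ->
  exists Phi, [/\ Phi \in K, Phi != 0 & forall Psi, Psi \in W -> dotL Phi Psi = 0].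
Proof.
move=> nKW sWK.
have ltWK : (\dim W < \dim K)%N.
  rewrite ltn_neqAle dimvS // andbT; apply: contra nKW => eqd.
  have /eqP -> // : W == K by rewrite eqEdim sWK (eqP eqd) leqnn.
pose f (Phi : L) : 'rV[R[i]]_(\dim W) := \row_i dotL Phi (vbasis W)`_i.
have fE Phi : linfun f Phi = f Phi.
  by rewrite linfunE // => a Psi Psi'; apply/rowP => i; rewrite !mxE dotL_linear.
have : (K :&: lker (linfun f))%VS != 0%VS.
  rewrite -dimv_eq0 -lt0n; have := limg_ker_dim (linfun f) K.
  have : (\dim (linfun f @: K) <= \dim W)%N.
    by apply: leq_trans (dimvS (subvf _)) _; rewrite dimvf /dim /= mul1n.
  by move: ltWK; clear; lia.
rewrite -vpick0; set Phi := vpick _ => Phi0; exists Phi.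
have : Phi \in (K :&: lker (linfun f))%VS by apply: memv_pick.
move=> /memv_capP[KPhi]; rewrite memv_ker fE => /eqP fPhi; split=> // Psi.
move=> /coord_vbasis->; rewrite dotLC; apply/eqP; rewrite conjC_eq0.
have sum0 (r : seq 'I_(\dim W)) (c : 'I_(\dim W) -> R[i]) :
    dotL (\sum_(i <- r) c i *: (vbasis W)`_i) Phi = 0.
  elim: r => [|i r IHr].
    by rewrite big_nil /dotL big1 // => H _; rewrite vals0 mul0r.
  rewrite big_cons dotL_linear IHr addr0 dotLC.
  by have := congr1 (fun v : 'rV_ _ => v 0 i) fPhi; rewrite !mxE => ->; rewrite rmorph0 mulr0.
by rewrite sum0.
Qed.

(** Let W be the part of K spanned by codewords.  Its orthogonal complement in K is
stable because the adjoint of a convolution is a convolution (dotL_conv) and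
restrictions are self-adjoint (dotL_proj).  If it is nonzero, the piece of it of largest rank is a combination of codewords by
max_rank_css, hence lies in W and is orthogonal to itself. *)
Lemma stable_css (K : {vspace L}) (Phi0 : L) (H0 : 'Hom(X, U)) :
    (\dim {:U} <= \dim {:X})%N -> stable (fun Phi => Phi \in K) ->
    Phi0 \in K -> vals Phi0 H0 != 0 ->
    (forall Phi H, Phi \in K -> vals Phi H != 0 -> (rk beta H <= rk beta H0)%N) ->
  [/\ (rk beta H0 <= \dim {:U})%N, ~~ odd (\dim {:U} - rk beta H0) &
      forall Phi, Phi \in K -> css_span beta (\dim {:U} - rk beta H0)./2 Phi].
Proof.
move=> leUX stK KPhi0 Phi0H maxH0.
have [Psi0 [KPsi0 Psi0H maxPsi0]] := max_rank_of_stable stK KPhi0 Phi0H maxH0.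
have [le_rt par _] := max_rank_css psi_char nd two_neq0 leUX maxPsi0 Psi0H.
split=> //; set d := _./2.
have [CSS CSSP] : exists W : {vspace L}, forall Phi, Phi \in W <-> css_span beta d Phi.
  by apply: vspace_of_closed; [exact: css_span0 | move=> a Phi Psi; exact: css_spanP].
pose W := (K :&: CSS)%VS.
suff /subvP sKW : (K <= W)%VS.
  by move=> Phi /sKW /memv_capP[_ /CSSP].
apply/negPn/negP => nKW.
have [Phi1 [KPhi1 nz1 ortho1]] := exists_orthogonal nKW (capvSl K CSS).
pose P Phi := Phi \in K /\ forall Psi, Psi \in W -> dotL Phi Psi = 0.
have stCSS (T : L -> L) : (forall a Phi Psi, T (a *: Phi + Psi) = a *: T Phi + T Psi) ->
    (forall N Psi, isotropic beta N -> css_code beta N Psi -> css_code beta N (T Psi)) ->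
    forall Psi, Psi \in CSS -> T Psi \in CSS.
  by move=> TP Tcode Psi /CSSP PsiC; apply/CSSP; apply: css_span_stable.
have stP : stable P.
  split=> [l xi Phi l0|x c Phi] [KPhi oPhi].
    split=> [|Psi /memv_capP[KPsi CPsi]]; first exact: (stable_conv stK).
    rewrite dotL_conv oPhi // memv_cap (stable_conv stK) ?oppr_eq0 //=.
    apply: (stCSS (Lconv psi beta (- l) xi)) => // [a Phi' Psi'|N Psi' isoN].
      exact: LconvP.
    by apply: css_code_conv; rewrite ?oppr_eq0.
  split=> [|Psi /memv_capP[KPsi CPsi]]; first exact: (stable_proj stK).
  rewrite dotL_proj oPhi // memv_cap (stable_proj stK) //=.
  apply: (stCSS (Lproj beta x c)) => // [a Phi' Psi'|N Psi' isoN].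
    exact: LprojP.
  exact: css_code_proj.
pose supp := fun H : finvect_type 'Hom(X, U) => `[< exists2 Phi, P Phi & vals Phi H != 0 >].
have [H1 Phi1H1] := vals_neq0 nz1.
have suppH1 : supp H1 by apply/asboolP; exists Phi1.
have := @arg_maxnP _ (H1 : finvect_type 'Hom(X, U)) supp (fun H => rk beta H) suppH1.
case=> H /asboolP[Phi PPhi PhiH] maxH.
have [|Psi [PPsi PsiH maxPsi]] := max_rank_of_stable stP PPhi PhiH.
  by move=> Psi G PPsi PsiG; apply: (maxH G); apply/asboolP; exists Psi.
have [_ _ codePsi] := max_rank_css psi_char nd two_neq0 leUX maxPsi PsiH.
have [KPsi oPsi] := PPsi.
have led : (d <= (\dim {:U} - rk beta H)./2)%N.
  by apply: half_leq; apply: leq_sub2l; apply: maxH0 PsiH.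
have WPsi : Psi \in W by rewrite memv_cap KPsi; apply/CSSP; apply: css_span_mono led codePsi.
by case/eqP: PsiH; rewrite (dotL_eq0 (oPsi Psi WPsi)) vals0.
Qed.

End InvariantSubspaces.

(** * The character omega *)

(** Distinct automorphisms are linearly independent. *)
Lemma galTrace_neq0 (F0 : fieldType) (L : splittingFieldType F0) (K E : {subfield L}) :
  exists2 a, a \in E & galTrace K E a != 0.
Proof.
have [a Ea nz] := gal_independent_contra (group1 'Gal(E / K)) (oner_neq0 L) (c_ := fun=> 1).
exists a => //; apply: contraNneq nz => tr0; rewrite -[X in _ == X]tr0; apply/eqP.
by apply: eq_bigr => y _; rewrite mul1r.
Qed.

Section OmegaCharacter.
Variables (p : nat) (F : finFieldType) (pcharFp : p \in [pchar F]) (R : realType).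
Local Notation Tr := (Tr pcharFp).
Local Notation om := (omega pcharFp R).

Lemma TrD (a b : F) : Tr (a + b) = Tr a + Tr b.
Proof.
apply: (fmorph_inj (in_alg (pPrimeCharType pcharFp))); rewrite rmorphD.
rewrite -[LHS]/((Tr (a + b))%:A) -[X in _ = X + _]/((Tr a)%:A) -[X in _ = _ + X]/((Tr b)%:A).
rewrite !TrE.
exact: (raddfD (galTrace 1%AS {:pPrimeCharType pcharFp})).
Qed.

Lemma Tr_neq0 : exists a : F, Tr a != 0.
Proof.
have [a _ nz] := galTrace_neq0 1%AS {:pPrimeCharType pcharFp}%AS.
exists (a : F); apply: contraNneq nz => Tra.
by rewrite -(TrE pcharFp (a : F)) Tra scale0r.
Qed.

Definition cexp (x : R) : R[i] := (cos x +i* sin x)%C.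

Lemma cexpD x y : cexp (x + y) = cexp x * cexp y.
Proof. by apply/eqP; rewrite eq_complex /= cosD sinD eqxx [X in _ == X]addrC !eqxx. Qed.

Lemma cexp2pi k : cexp (pi *+ 2 *+ k) = 1.
Proof.
elim: k => [|k IHk].
  by apply/eqP; rewrite mulr0n /cexp cos0 sin0.
by rewrite [_ *+ k.+1]mulrS cexpD IHk mulr1 /cexp cos2pi sin2pi.
Qed.

Lemma omegaE a : om a = cexp (2 * pi / p%:R * (Tr a)%:R).
Proof. by []. Qed.

Let p_prime : prime p := pcharf_prime pcharFp.

(** The exponent in omega is the representative of Tr a in [0, p[; sums of
representatives only agree with representatives of sums modulo p. *)
Lemma cexp_modn m : cexp (2 * pi / p%:R * m%:R) = cexp (2 * pi / p%:R * (m %% p)%:R).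
Proof.
have p0 : p%:R != 0 :> R by rewrite pnatr_eq0 -lt0n prime_gt0.
rewrite {1}(divn_eq m p) natrD [_ * (_ + _)]mulrDr cexpD natrM.
have -> : 2 * pi / p%:R * ((m %/ p)%:R * p%:R) = pi *+ 2 *+ (m %/ p) :> R.
  by rewrite -[RHS]mulr_natr -[pi *+ 2]mulr_natr; field.
by rewrite cexp2pi mul1r.
Qed.

Lemma omegaD a b : om (a + b) = om a * om b.
Proof.
rewrite !omegaE TrD -cexpD -mulrDr -natrD [RHS]cexp_modn.
by rewrite -[X in (_ %% X)%N](Fp_cast p_prime).
Qed.

(** With k = Tr a in ]0, p[ and y = pi k / p, cos (2 y) = 1 - 2 (sin y)^2 < 1. *)
Lemma omega_neq1 : exists a, om a != 1.
Proof.
have [a Tra] := Tr_neq0; exists a; rewrite omegaE.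
have k_gt0 : (0 < Tr a)%N by rewrite lt0n.
have k_ltp : (Tr a < p)%N by apply: leq_trans (ltn_ord (Tr a)) _; rewrite Fp_cast.
move: (nat_of_ord (Tr a)) k_gt0 k_ltp => k k_gt0 k_ltp.
have p0 : 0 < p%:R :> R by rewrite ltr0n prime_gt0.
apply/negP => /eqP[cos1 _]; pose y : R := pi * (k%:R / p%:R).
have siny : 0 < sin y.
  have kp : 0 < k%:R / p%:R :> R by rewrite divr_gt0 // ltr0n.
  apply: sin_gt0_pi; rewrite mulr_gt0 ?pi_gt0 //=.
  by rewrite gtr_pMr ?pi_gt0 // ltr_pdivrMr // mul1r ltr_nat.
have : cos (y *+ 2) = 1.
  by rewrite -[RHS]cos1; congr cos; rewrite /y -mulr_natr; ring.
rewrite cos_mulr2n cos2sin2 => /eqP; rewrite -subr_eq0.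
have -> : (1 - sin y ^+ 2) *+ 2 - 1 - 1 = - (sin y ^+ 2 *+ 2) by ring.
rewrite oppr_eq0 mulrn_eq0 /= sqrf_eq0 => /eqP siny0.
by move: siny; rewrite siny0 ltxx.
Qed.

Lemma omega_character : additive_character om.
Proof.
have om0 : om 0 = 1.
  have Tr0 : Tr 0 = 0 by apply: (addrI (Tr 0)); rewrite -TrD !addr0.
  by rewrite omegaE Tr0 mulr0 -(mulr0n (pi *+ 2)) cexp2pi.
have omJ a : om a * (om a)^* = 1.
  rewrite omegaE; move: (2 * pi / p%:R * _ : R) => x; apply/eqP; rewrite eq_complex /=.
  by rewrite !mulrN opprK -!expr2 cos2Dsin2 eqxx [cos x * _]mulrC addNr eqxx.
split=> // [|a|]; [exact: omegaD | | exact: omega_neq1].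
have om_neq0 : om a != 0.
  by apply: contra_eq_neq (omJ a) => ->; rewrite mul0r eq_sym oner_neq0.
by apply: (mulfI om_neq0); rewrite omJ -omegaD subrr.
Qed.

End OmegaCharacter.

(** * The action of Sp(V) on the tensor product *)
Section SymplecticTensor.
Variables (F : finFieldType) (X U : vectType F) (beta : {symmetric U}).
Implicit Types (H G : 'Hom(X, U)) (A : 'Hom(dual X, X)) (x : X) (y : dual X).

(** Every element of (U (x) X) + (U (x) X* ) is a sum of tensors of basis vectors. *)
Lemma id_tens_unique (S : 'End((X * dual X)%type)) (T : 'End(UV X U)) :
  (forall u v, T (tens u v) = tens u (S v)) -> id_tens U S = T.
Proof.
move=> Ttens; apply/lfunP => -[G H].
have pair_sum (I : Type) (r : seq I) (f : I -> UV X U) :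
    \sum_(i <- r) f i = (\sum_(i <- r) (f i).1, \sum_(i <- r) (f i).2).
  by rewrite [LHS]surjective_pairing; congr (_, _);
    [exact: (big_morph fst) | exact: (big_morph snd)].
have -> : (G, H) = \sum_i (tens (G (dbas i)) (bas i, 0) + tens (H (bas i)) (0, dbas i)) :> UV X U.
  rewrite pair_sum; congr (_, _); apply/lfunP => z; rewrite sum_lfunE.
    rewrite {1}(dbas_sum z) linear_sum; apply: eq_bigr => i _.
    by rewrite add_lfunE !tensXE linear0 scale0r addr0 linearZ.
  rewrite {1}(bas_sum z) linear_sum; apply: eq_bigr => i _.
  by rewrite add_lfunE !tensX'E zero_lfunE scale0r add0r linearZ.
rewrite !linear_sum; apply: eq_bigr => i _.
by rewrite !linearD /= !id_tensE !Ttens.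
Qed.

(** Id_U (x) A, read on Hom(X, U) = U (x) X*. *)
Definition pre A : 'Hom('Hom(X, U), 'Hom(dual X, U)) :=
  linfun (fun H : 'Hom(X, U) => (H \o A)%VF).

Lemma preE A H y : pre A H y = H (A y).
Proof.
rewrite /pre linfunE ?comp_lfunE // => a G G'.
by apply/lfunP => z; rewrite !(comp_lfunE, add_lfunE, scale_lfunE).
Qed.

Lemma id_tens_N A : symmetric_map (@eval F X) A -> id_tens U (N_map A) = N_map (pre A).
Proof.
move=> symA; apply: id_tens_unique => u v; rewrite !N_mapE; congr (_, _).
apply/lfunP => y; rewrite add_lfunE preE !tensXE tensX'E -scalerDl linearD /=.
by congr ((_ + _) *: _); apply: symA.
Qed.

Lemma dbas_bas (i j : 'I_(\dim {:X})) : dbas i (bas j) = (i == j)%:R :> F.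
Proof. by rewrite dbasE /bas coord_free ?(basis_free (vbasisP _)) // eq_sym. Qed.

(** In the basis (e_j), A has the symmetric matrix e_j^* (A e_i^* ). *)
Lemma tens_pair_pre A H G : symmetric_map (@eval F X) A ->
  tens_pair beta (pre A H) G = tens_pair beta (pre A G) H.
Proof.
move=> symA; rewrite /tens_pair.
have expand H1 G1 : \sum_i beta (pre A H1 (dbas i)) (G1 (bas i)) =
    \sum_i \sum_j (dbas j (A (dbas i)) : F) * beta (H1 (bas j)) (G1 (bas i)).
  apply: eq_bigr => i _; rewrite preE {1}(bas_sum (A (dbas i))) linear_sum linear_sumlz.
  by apply: eq_bigr => j _; rewrite linearZ /= betaZl.
rewrite !expand exchange_big /=; apply: eq_bigr => i _; apply: eq_bigr => j _.
by rewrite betaC; congr (_ * _); apply: symA.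
Qed.

Lemma symmetric_pre A : symmetric_map (@eval F X) A ->
  symmetric_map (tens_pair beta) (pre A).
Proof. by move=> symA H G; apply: tens_pair_pre. Qed.

Lemma lfun_trE (C : 'End(X)) : lfun_tr C = \sum_i (dbas i (C (bas i)) : F).
Proof.
rewrite /lfun_tr /mxtrace; apply: eq_bigr => i _.
by rewrite /mxof mxE /= mxE vecof_delta dbasE.
Qed.

(** The character by which N_A acts on delta H: its weight is half of gram H. *)
Lemma qform_pre_tr A H : symmetric_map (@eval F X) A ->
  qform (tens_pair beta) (pre A) H H = lfun_tr (A \o gram beta H)%VF.
Proof.
move=> symA; rewrite lfun_trE; apply: eq_bigr => i _.
by rewrite preE comp_lfunE betaC -gramE; apply: symA.
Qed.

(** c times the square x (x) x. *)
Definition square_map (c : F) x : 'Hom(dual X, X) :=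
  linfun (fun y : dual X => (c * (y x : F)) *: x).

Lemma square_mapE c x y : square_map c x y = (c * (y x : F)) *: x.
Proof.
rewrite /square_map linfunE // => a y1 y2.
by rewrite add_lfunE scale_lfunE mulrDr scalerDl scalerA; congr (_ *: _ + _); rewrite mulrCA.
Qed.

Lemma symmetric_square c x : symmetric_map (@eval F X) (square_map c x).
Proof.
move=> y y'; rewrite /qform /eval !square_mapE !linearZ /= /GRing.scale /=; ring.
Qed.

Lemma qform_pre_square c x H :
  qform (tens_pair beta) (pre (square_map c x)) H H = c * beta (H x) (H x).
Proof.
have Hx : H x = \sum_i (dbas i x : F) *: H (bas i).
  by rewrite {1}(bas_sum x) linear_sum; apply: eq_bigr => i _; rewrite linearZ.
rewrite /qform /tens_pair [in X in _ = _ * beta _ X]Hx linear_sumr mulr_sumr.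
by apply: eq_bigr => i _; rewrite preE square_mapE linearZ /= betaZl betaZr; ring.
Qed.

(** The identification of X* with X that takes the dual basis to the basis; it serves
as the B of a Fourier transform J_B. *)
Definition dual_iso : 'Hom(dual X, X) :=
  linfun (fun y : dual X => \sum_i (y (bas i) : F) *: bas i).

Lemma dual_isoE y : dual_iso y = \sum_i (y (bas i) : F) *: bas i.
Proof.
rewrite /dual_iso linfunE // => a y1 y2; rewrite scaler_sumr -big_split /=.
by apply: eq_bigr => i _; rewrite add_lfunE scale_lfunE scalerDl scalerA.
Qed.

Lemma symmetric_dual_iso : symmetric_map (@eval F X) dual_iso.
Proof.
move=> y y'; rewrite /qform /eval !dual_isoE !linear_sum; apply: eq_bigr => i _.
by rewrite !linearZ /= /GRing.scale /= mulrC.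
Qed.

Lemma dual_iso_bij : bijective dual_iso.
Proof.
have dbas_iso y i : dbas i (dual_iso y) = y (bas i) :> F.
  rewrite dual_isoE linear_sum (bigD1 i) //= big1 => [|j ji].
    by rewrite addr0 linearZ /= dbas_bas eqxx /GRing.scale /= mulr1.
  by rewrite linearZ /= dbas_bas eq_sym (negPf ji) /GRing.scale /= mulr0.
exists (fun x : X => \sum_i (dbas i x : F) *: dbas i) => [y|x].
  by rewrite [RHS]dbas_sum; apply: eq_bigr => i _; rewrite dbas_iso.
rewrite dual_isoE [RHS]bas_sum; apply: eq_bigr => i _; congr (_ *: _).
rewrite sum_lfunE (bigD1 i) //= big1 => [|j ji].
  by rewrite addr0 scale_lfunE dbas_bas eqxx /GRing.scale /= mulr1.
by rewrite scale_lfunE dbas_bas (negPf ji) /GRing.scale /= mulr0.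
Qed.

Lemma qform_pre_rank1 A (u : U) y H : symmetric_map (@eval F X) A ->
  qform (tens_pair beta) (pre A) (tensX' u y) H = beta u (H (A y)).
Proof.
move=> symA; rewrite /qform /tens_pair [in RHS](bas_sum (A y)) linear_sum linear_sumr.
apply: eq_bigr => i _; rewrite preE tensX'E linearZ /= betaZl betaZr.
by congr (_ * _); apply: symA.
Qed.

Lemma lfun_bijK (V W : vectType F) (f : 'Hom(V, W)) : bijective f ->
  cancel f (f^-1)%VF /\ cancel (f^-1)%VF f.
Proof.
move=> [g fK gK].
have ker0 : lker f == 0%VS.
  rewrite -subv0; apply/subvP => v; rewrite memv_ker memv0 => /eqP fv.
  by rewrite -[v]fK fv -(linear0 f) fK.
have K1 := lker0_lfunK ker0; split=> // w.
by rewrite -[w]gK K1.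
Qed.

Lemma bijectiveN (V W : vectType F) (f : 'Hom(V, W)) : bijective f -> bijective (- f).
Proof.
move=> [g fK gK]; exists (fun w => g (- w)) => v; rewrite opp_lfunE.
  by rewrite opprK fK.
by rewrite gK opprK.
Qed.

Lemma bijective_pre A : bijective A -> bijective (pre A).
Proof.
move=> /lfun_bijK[AK KA].
exists (fun G : 'Hom(dual X, U) => (G \o A^-1)%VF) => G; apply/lfunP => z.
  by rewrite comp_lfunE preE KA.
by rewrite preE comp_lfunE AK.
Qed.

Lemma symplectic_N A : symmetric_map (@eval F X) A -> symplectic (@eval F X) (N_map A).
Proof.
move=> symA v w; rewrite /sympl_form !N_mapE /eval /= !linearD /=.
have := symA v.2 w.2; rewrite /qform /eval => ->; ring.
Qed.

Lemma symplectic_J (Y Y' : vectType F) (pair : Y -> Y' -> F) (B : 'Hom(Y', Y)) :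
  (forall (v : Y) (w : Y'), pair v (- w) = - pair v w) ->
  symmetric_map pair B -> bijective B -> symplectic pair (J_map B).
Proof.
move=> pairN symB /lfun_bijK[BK KB] v w; rewrite /sympl_form !J_mapE /= !pairN.
have := symB v.2 ((B^-1)%VF w.1); rewrite /qform KB => ->.
by have := symB w.2 ((B^-1)%VF v.1); rewrite /qform KB => ->; rewrite opprK addrC.
Qed.

Lemma id_tens_J A : symmetric_map (@eval F X) A -> bijective A ->
  id_tens U (J_map A) = J_map (pre A).
Proof.
move=> symA bijA; have [AK KA] := lfun_bijK bijA.
have [BK KB] := lfun_bijK (bijective_pre bijA).
apply: id_tens_unique => u v; rewrite !J_mapE; congr (_, _).
  apply/lfunP => y; rewrite preE tensX'E tensXE; congr (_ *: _); exact: symA.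
apply: oppr_inj; rewrite opprK; apply: (can_inj BK); rewrite KB.
apply/lfunP => y; rewrite preE opp_lfunE tensX'E tensXE opp_lfunE scaleNr opprK.
congr (_ *: _); have := symA ((A^-1)%VF v.1) y.
by rewrite /qform /eval KA => <-.
Qed.

Lemma J_mapK (Y Y' : vectType F) (B : 'Hom(Y', Y)) : bijective B ->
  (J_map B \o J_map (- B))%VF = \1%VF.
Proof.
move=> bijB; have [BK KB] := lfun_bijK bijB; have [NK KN] := lfun_bijK (bijectiveN bijB).
apply/lfunP => v; rewrite comp_lfunE !J_mapE id_lfunE /= [RHS]surjective_pairing.
congr (_, _); first by rewrite linearN -opp_lfunE KN.
by rewrite opp_lfunE linearN opprK; apply: BK.
Qed.

End SymplecticTensor.

(** * Subrepresentations are stable *)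
Section OscillatorAction.
Variables (p : nat) (F : finFieldType) (pcharFp : p \in [pchar F]) (R : realType).
Variables (X U : vectType F) (beta : {symmetric U}).
Variable mu : 'End(UV X U) -> 'End(L2 R 'Hom(X, U)).
Hypothesis two_neq0 : 2%:R != 0 :> F.
Hypothesis osc : oscillator pcharFp (tens_pair beta) mu.
Local Notation L := (L2 R 'Hom(X, U)).
Local Notation om := (omega pcharFp R).
Implicit Types (Phi Psi : L) (H G : 'Hom(X, U)) (xi : dual X) (A : 'Hom(dual X, X)).

Let om_char : additive_character om := omega_character pcharFp R.

Lemma vals_delta G H : vals (delta R G) H = (H == G)%:R.
Proof. by rewrite /vals /delta ffunE. Qed.

Lemma delta_sum Phi :
  Phi = \sum_(G : finvect_type 'Hom(X, U)) vals Phi G *: delta R (G : 'Hom(X, U)).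
Proof.
apply: eq_vals => H; rewrite vals_sum (bigD1 (H : finvect_type 'Hom(X, U))) //= big1 => [|G GH].
  by rewrite addr0 valsZ vals_delta eqxx mulr1.
by rewrite valsZ vals_delta eq_sym (negPf GH) mulr0.
Qed.

Lemma eq_on_delta (T1 T2 : L -> L) :
  (forall a Phi Psi, T1 (a *: Phi + Psi) = a *: T1 Phi + T1 Psi) ->
  (forall a Phi Psi, T2 (a *: Phi + Psi) = a *: T2 Phi + T2 Psi) ->
  (forall G : 'Hom(X, U), T1 (delta R G) = T2 (delta R G)) ->
  forall Phi, T1 Phi = T2 Phi.
Proof.
move=> lin1 lin2 eqT Phi.
have T0 (T : L -> L) : (forall a Phi Psi, T (a *: Phi + Psi) = a *: T Phi + T Psi) -> T 0 = 0.
  by move=> lin; have := lin (-1) 0 0; rewrite scaler0 addr0 scaleN1r addNr.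
rewrite (delta_sum Phi); elim: (index_enum _) => [|G r IHr]; first by rewrite !big_nil !T0.
by rewrite !big_cons lin1 lin2 IHr eqT.
Qed.

Lemma mu_N A Phi H : symmetric_map (@eval F X) A ->
  vals (mu (id_tens U (N_map A)) Phi) H =
    om (2%:R^-1 * qform (tens_pair beta) (pre U A) H H) * vals Phi H.
Proof.
move=> symA; rewrite id_tens_N //.
pose c G := om (2%:R^-1 * qform (tens_pair beta) (pre U A) G G).
pose T Psi : L := of_vals (fun G => c G * vals Psi G).
have TE Psi G : vals (T Psi) G = c G * vals Psi G by rewrite of_valsE.
suff -> : mu (N_map (pre U A)) Phi = T Phi by rewrite TE.
apply: (eq_on_delta (T1 := mu _) (T2 := T)) => [a Psi Psi'|a Psi Psi'|G]; first exact: linearP.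
  by apply: eq_vals => G; rewrite valsP !TE valsP mulrDr mulrCA.
rewrite (osc_N osc); last exact: symmetric_pre.
apply: eq_vals => G'.
rewrite valsZ TE !vals_delta.
by have [->|] := eqVneq G' G; rewrite ?mulr1 // !mulr0.
Qed.

(** Up to a scalar, mu (J_B) is the Fourier transform for the pairing of B. *)
Lemma mu_J_delta A G H : symmetric_map (@eval F X) A -> bijective A ->
  vals (mu (id_tens U (J_map A)) (delta R G)) H =
    (gauss_sum pcharFp R (tens_pair beta) (pre U A))^-1 * om (qform (tens_pair beta) (pre U A) G H).
Proof.
move=> symA bijA; rewrite id_tens_J //.
rewrite (osc_J osc); [|exact: symmetric_pre|exact: bijective_pre].
rewrite valsZ vals_sum; congr (_ * _).
rewrite (bigD1 (H : finvect_type 'Hom(X, U))) //= big1 => [|G' G'H].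
  by rewrite addr0 valsZ vals_delta eqxx mulr1.
by rewrite valsZ vals_delta eq_sym (negPf G'H) mulr0.
Qed.

Lemma mu_JK A Phi : symmetric_map (@eval F X) A -> bijective A ->
  mu (id_tens U (J_map A)) (mu (id_tens U (J_map (- A))) Phi) = Phi.
Proof.
move=> symA bijA.
have symN : symmetric_map (@eval F X) (- A).
  by move=> y y'; have := symA y y'; rewrite /qform /eval !opp_lfunE !linearN /= => ->.
have bijN := bijectiveN bijA.
have preN : pre U (- A) = - pre U A.
  by apply/lfunP => H; apply/lfunP => y; rewrite !(preE, opp_lfunE) linearN.
have pairN (G : 'Hom(dual X, U)) (H : 'Hom(X, U)) :
    tens_pair beta G (- H) = - tens_pair beta G H.
  rewrite /tens_pair -sumrN; apply: eq_bigr => i _.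
  by rewrite opp_lfunE betaNr.
rewrite -comp_lfunE !id_tens_J // -(osc_M osc).
- by rewrite preN J_mapK ?(osc_1 osc) ?id_lfunE //; apply: bijective_pre.
- by apply: symplectic_J => //; [exact: symmetric_pre | exact: bijective_pre].
- by apply: symplectic_J => //; [exact: symmetric_pre | exact: bijective_pre].
Qed.

(** Checked on delta functions G, whose Fourier transforms are exponentials.  The
sum over u of psi (l beta(u, u) + beta(u, G x)), with x = b xi, is evaluated by
completing the square with w = G x / (2 l): it is the Gauss sum in front times
psi (- beta(G x, G x) / (4 l)), the phase by which N_A acts for
A = - (2 l)^-1 x (x) x. *)
Lemma conv_mu_J l xi (b := dual_iso X) Phi : l != 0 ->
  Lconv om beta l xi (mu (id_tens U (J_map b)) Phi) =
  (\sum_(u : finvect_type U) om (l * beta (u : U) u)) *: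
    mu (id_tens U (J_map b)) (mu (id_tens U (N_map (square_map (- (2%:R * l)^-1) (b xi)))) Phi).
Proof.
move=> l0; have symb := @symmetric_dual_iso F X; have bijb := dual_iso_bij X.
set g := \sum_(u : _) _; set N := N_map _.
have symA := symmetric_square (- (2%:R * l)^-1) (b xi).
move: Phi; apply: eq_on_delta => [a Phi Psi|a Phi Psi|G].
- by rewrite linearP LconvP.
- by rewrite !linearP.
have -> : mu (id_tens U N) (delta R G) =
    om (2%:R^-1 * (- (2%:R * l)^-1 * beta (G (b xi)) (G (b xi)))) *: delta R G.
  by rewrite id_tens_N // (osc_N osc) ?qform_pre_square //; exact: symmetric_pre.
apply: eq_vals => H; rewrite Lconv_vals /conv linearZ scalerA valsZ.
rewrite mu_J_delta //.
under eq_bigr => u _ do rewrite mu_J_delta // mulrCA.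
rewrite -mulr_sumr mulrCA; congr (_ * _).
pose w := (2%:R * l)^-1 *: G (b xi).
rewrite /g -(sum_translate (fun u : U => om (l * beta u u)) w) mulrAC mulrC !mulr_suml mulr_sumr.
apply: eq_bigr => u _.
have -> : qform (tens_pair beta) (pre U b) G (H + tensX' (u : U) xi) =
    qform (tens_pair beta) (pre U b) G H + beta (u : U) (G (b xi)).
  rewrite -(qform_pre_rank1 _ _ _ _ symb) (symmetric_pre beta symb _ G).
  rewrite /qform /tens_pair -big_split /=; apply: eq_bigr => i _.
  by rewrite add_lfunE betaDr.
rewrite -!(charD om_char); congr om.
rewrite /w !(betaDl, betaDr, betaZl, betaZr) (betaC beta (G (b xi)) u); field.
by rewrite two_neq0 l0.
Qed.

Variable K : {vspace L}.
Hypothesis Kstable : Sp_subrep mu K.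

(** The average over l of psi (l (beta(H x, H x) - c)) is the indicator of
beta(H x, H x) = c. *)
Lemma subrep_proj x c Phi : Phi \in K -> Lproj beta x c Phi \in K.
Proof.
move=> KPhi; pose A (l : F) := square_map (2%:R * l) x.
have symA l : symmetric_map (@eval F X) (A l) by apply: symmetric_square.
have cF0 : #|F|%:R != 0 :> R[i].
  by rewrite pnatr_eq0 -lt0n; apply/card_gt0P; exists 0.
have -> : Lproj beta x c Phi =
    #|F|%:R^-1 *: \sum_(l : F) om (- (l * c)) *: mu (id_tens U (N_map (A l))) Phi.
  apply: eq_vals => H; rewrite Lproj_vals valsZ vals_sum.
  transitivity (#|F|%:R^-1 * (\sum_(l : F) om (l * (beta (H x) (H x) - c)) * vals Phi H)).
    rewrite -mulr_suml (sum_char om_char) subr_eq0.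
    by case: eqP => _; rewrite ?muln1 ?muln0 ?mul0r ?mulr0 // mulrA mulVf // mul1r.
  congr (_ * _); apply: eq_bigr => l _.
  rewrite valsZ mu_N // mulrA -(charD om_char).
  by rewrite qform_pre_square; congr (om _ * _); field.
apply: rpredZ; apply: rpred_sum => l _; apply: rpredZ.
by apply: Kstable => //; apply: symplectic_N.
Qed.

(** Phi = mu (J_b) Psi with Psi = mu (J_(-b)) Phi in K, to which conv_mu_J applies. *)
Lemma subrep_conv l xi Phi : l != 0 -> Phi \in K -> Lconv om beta l xi Phi \in K.
Proof.
move=> l0 KPhi; have symb := @symmetric_dual_iso F X; have bijb := dual_iso_bij X.
have evalN (x : X) (y : dual X) : eval x (- y) = - eval x y by rewrite /eval opp_lfunE.
have sympJ A : symmetric_map (@eval F X) A -> bijective A -> symplectic (@eval F X) (J_map A).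
  exact: symplectic_J.
have symN : symmetric_map (@eval F X) (- dual_iso X).
  by move=> y y'; have := symb y y'; rewrite /qform /eval !opp_lfunE !linearN /= => ->.
rewrite -(mu_JK Phi symb bijb) conv_mu_J //; apply: rpredZ.
apply: Kstable; first exact: sympJ.
apply: Kstable; first by apply: symplectic_N; apply: symmetric_square.
by apply: Kstable KPhi; apply: sympJ => //; apply: bijectiveN.
Qed.

Lemma subrep_stable : stable om beta (fun Phi => Phi \in K).
Proof. by split=> [l xi Phi|x c Phi]; [exact: subrep_conv | exact: subrep_proj]. Qed.

Lemma dim_limgZ (a : F) (B : 'Hom(X, dual X)) : a != 0 ->
  \dim (limg (a *: B)) = \dim (limg B).
Proof.
move=> a0; congr (\dim _); apply/eqP; rewrite eqEsubv; apply/andP; split; apply/subvP => w.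
  by move=> /memv_imgP[x _ ->]; rewrite scale_lfunE rpredZ ?memv_img ?memvf.
move=> /memv_imgP[x _ ->]; have -> : B x = (a *: B) (a^-1 *: x).
  by rewrite scale_lfunE linearZ /= scalerA divff // scale1r.
by rewrite memv_img ?memvf.
Qed.

Lemma weight_of_support Phi H : Phi \in K -> vals Phi H != 0 ->
  N_weight pcharFp mu K (2%:R^-1 *: gram beta H).
Proof.
move=> KPhi PhiH; split=> [x x'|].
  by rewrite /eval !scale_lfunE !gramE betaC.
have [Psi [KPsi PsiH PsiG]] := restrict_gram two_neq0 subrep_stable KPhi PhiH.
exists Psi; split=> // [|A symA].
  by apply: contraNneq PsiH => ->; rewrite vals0.
apply: eq_vals => G; rewrite mu_N // valsZ.
have [->|/PsiG GH] := eqVneq (vals Psi G) 0; first by rewrite !mulr0.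
rewrite qform_pre_tr // GH; congr (om _ * _).
rewrite !lfun_trE mulr_sumr; apply: eq_bigr => i _.
by rewrite !comp_lfunE scale_lfunE !linearZ.
Qed.

(** At a point H of the support, the weight is determined by its values on the squares
x (x) x, that is, by the quadratic form of B. *)
Lemma weight_support B : N_weight pcharFp mu K B ->
  exists Phi H, [/\ Phi \in K, vals Phi H != 0 & B = 2%:R^-1 *: gram beta H].
Proof.
move=> [symB [Phi [KPhi Phi0 actPhi]]].
have [H PhiH] := vals_neq0 Phi0; exists Phi, H; split=> //.
have sq x : B x x = 2%:R^-1 * beta (H x) (H x) :> F.
  apply: (char_inj om_char) => c.
  have symA := symmetric_square c x.
  have := congr1 (fun Psi => vals Psi H) (actPhi _ symA).
  rewrite mu_N // valsZ => /(mulIf PhiH).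
  rewrite qform_pre_square mulrCA => ->; congr om.
  have trE : lfun_tr (square_map c x \o B)%VF = c * (B x x : F).
    have -> : B x x = \sum_i (dbas i x : F) * (B (bas i) x : F) :> F.
      rewrite {1}(bas_sum x) linear_sum sum_lfunE; apply: eq_bigr => i _.
      by rewrite linearZ scale_lfunE.
    rewrite lfun_trE mulr_sumr; apply: eq_bigr => i _.
    by rewrite comp_lfunE square_mapE linearZ /= /GRing.scale /=; ring.
  by rewrite trE.
apply/lfunP => x; apply/lfunP => x'; rewrite !scale_lfunE gramE.
have Bxx' : B x' x = B x x' :> F by have := symB x x'; rewrite /eval.
have /eqP := sq (x + x').
rewrite !linearD /= !add_lfunE !(betaDl, betaDr) !sq Bxx' (betaC beta (H x') (H x)).
set b := B x x'; set c := beta (H x) (H x') => eq2.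
have : 2%:R * ((b : F) - 2%:R^-1 * c) = 0.
  move: eq2; rewrite -subr_eq0 => /eqP eq2; rewrite -[RHS]eq2; ring.
by move/eqP; rewrite mulf_eq0 (negPf two_neq0) subr_eq0 => /eqP.
Qed.

End OscillatorAction.

Theorem theorem1p2 (p : nat) (F : finFieldType) (pcharFp : p \in [pchar F])
    (R : realType) (n t r : nat) (X U : vectType F) (beta : {symmetric U})
    (mu : 'End(UV X U) -> 'End(L2 R 'Hom(X, U)))
    (K : {vspace L2 R 'Hom(X, U)}) :
  odd p ->
  \dim {:X} = n ->
  \dim {:U} = t ->
  nondegenerate beta ->
  oscillator pcharFp (tens_pair beta) mu ->
  (t <= n)%N ->
  Sp_subrep mu K ->
  rep_rank pcharFp mu K r ->
  [/\ (r <= t)%N, ~~ odd (t - r) &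
      forall Phi, Phi \in K -> css_span beta (t - r)./2 Phi].
Proof.
move=> odd_p <- <- nd osc le_tn Ksub [[B wB <-] maxB].
have two_neq0 : 2%:R != 0 :> F.
  rewrite -(dvdn_pcharf pcharFp); apply: contraL odd_p => p_dvd2.
  have p_gt1 := prime_gt1 (pcharf_prime pcharFp).
  by have /eqP <- : 2 == p by rewrite eqn_leq p_gt1 (dvdn_leq _ p_dvd2).
have omc := omega_character pcharFp R.
have half_neq0 : 2%:R^-1 != 0 :> F by rewrite invr_eq0.
have [Phi [H [KPhi PhiH BE]]] := weight_support two_neq0 osc wB.
rewrite BE (dim_limgZ _ half_neq0) -/(rk beta H) in maxB *.
apply: (stable_css omc nd two_neq0 le_tn (subrep_stable two_neq0 osc Ksub) KPhi PhiH).
move=> Psi G KPsi PsiG.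
have := maxB _ (weight_of_support two_neq0 osc Ksub KPsi PsiG).
by rewrite (dim_limgZ _ half_neq0).
Qed.
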